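(* Let $\mu,\nu$ be Borel probability measures on $[0,1)$. Assume that $\mu$ does not charge the boundaries of intervals in $\mathcal{D}$ (that is, $\mu(\{j2^{-k}\}) = 0$ for all integers $j,k\ge 0$), and that $\nu$ is dyadically doubling: there is $C \geq 1$ with $\nu(\hat I) \leq C\nu(I)$ for all $I \in \mathcal{D}\setminus\{[0,1)\}$. Write $\mu = \mu_a + \mu_s$ for the Lebesgue decomposition of $\mu$ relative to $\nu$ ($\mu_a \ll \nu$, $\mu_s \perp \nu$). Define the square function $$\mathcal{S}^2_{\mathcal{D},\nu}(\mu)(x) = \sum_{I \in \mathcal{D}} \alpha_{\mu,\nu}^2(I)\chi_I(x), \qquad x \in [0,1).$$ Then (a) $\mathcal{S}_{\mathcal{D},\nu}(\mu)(x) < \infty$ for $\mu_a$-almost every $x$, and (b) $\mathcal{S}_{\mathcal{D},\nu}(\mu)(x) = \infty$ for $\mu_s$-almost every $x$.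
   Context: $\mathcal{D}$ denotes the family of dyadic intervals $[j2^{-k},(j+1)2^{-k}) \subset [0,1)$, $k \geq 0$. For $I \in \mathcal{D}$, $\hat I$ is its parent (the smallest dyadic interval strictly containing $I$). Wasserstein distance: for finite Borel measures $\nu_1,\nu_2$ on $\mathbb{R}$, $\mathbb{W}_1(\nu_1,\nu_2) := \sup_\psi |\int\psi\,d\nu_1 - \int\psi\,d\nu_2|$, the supremum over all $1$-Lipschitz $\psi\colon\mathbb{R}\to\mathbb{R}$ supported on $[0,1]$. For an interval $I\subset\mathbb{R}$, $T_I$ is the increasing affine map taking $\overline{I}$ onto $[0,1]$, $\mu_I := T_{I\sharp}(\mu|_I)/\mu(I)$ and $\nu_I := T_{I\sharp}(\nu|_I)/\nu(I)$ (with $\mu_I :\equiv 0$ if $\mu(I)=0$, similarly for $\nu$), and $\alpha_{\mu,\nu}(I) := \mathbb{W}_1(\mu_I,\nu_I)$. *)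

(* Defs.v *)
From HB Require Import structures.
From mathcomp Require Import all_boot all_order all_algebra.
From mathcomp Require Import all_classical all_reals all_analysis.
Set Implicit Arguments. Unset Strict Implicit. Unset Printing Implicit Defensive.
Import Order.TTheory GRing.Theory Num.Theory.
Import numFieldNormedType.Exports.
Local Open Scope classical_set_scope.
Local Open Scope ring_scope.

(* The dyadic interval I_{k,j} = [j 2^-k, (j+1) 2^-k) (members of D: j < 2^k). *)
Definition dyadic {R : realType} (k j : nat) : set R :=
  `[ (j%:R / 2 ^+ k), (j.+1%:R / 2 ^+ k) [%classic.

(* T_I for I = I_{k,j}: increasing affine map sending closure(I) onto [0,1]. *)
Definition Tdy {R : realType} (k j : nat) (x : R) : R := 2 ^+ k * x - j%:R.

Definition lip1_supp01 {R : realType} (psi : R -> R) : Prop :=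
  (forall x y, `|psi x - psi y| <= `|x - y|) /\
  (forall x, (x < 0 \/ 1 < x) -> psi x = 0).

(* \int psi d(mu_I), mu_I = T_I # (mu|_I) / mu(I), and mu_I := 0 if mu(I) = 0. *)
Definition int_normalized {R : realType} (mu : {measure set R -> \bar R})
    (k j : nat) (psi : R -> R) : \bar R :=
  if mu (dyadic k j) == 0%E then 0%E
  else ((\int[mu]_(x in dyadic k j) (psi (Tdy k j x))%:E) / mu (dyadic k j))%E.

(* alpha_{mu,nu}(I_{k,j}) = W_1(mu_I, nu_I). *)
Definition alpha {R : realType} (mu nu : {measure set R -> \bar R}) (k j : nat)
  : \bar R :=
  ereal_sup [set `| int_normalized mu k j psi - int_normalized nu k j psi |%E
            | psi in [set psi | lip1_supp01 psi]].

(* S^2_{D,nu}(mu)(x) = sum_{I in D} alpha^2(I) chi_I(x), enumerating D by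
   levels k and positions j < 2^k (nonnegative terms). *)
Definition square_fun2 {R : realType} (mu nu : {measure set R -> \bar R}) (x : R)
  : \bar R :=
  (\sum_(0 <= k <oo)
     \sum_(j < 2 ^ k) (alpha mu nu k j * alpha mu nu k j
                        * (\1_(dyadic k j) x)%:E))%E.

Definition mutually_singular {R : realType} (m1 m2 : {measure set R -> \bar R})
  : Prop :=
  exists A : set R, [/\ measurable A, m2 A = 0%E & m1 (~` A) = 0%E].

(* Main.v *)
(** Write p_I = mu(I)/nu(I), and let d_I be the difference of the fractions of
    mu(I) and nu(I) that lie in the left child I_- of I.

    (a) Transporting one generation at a time, the Wasserstein distance b_I of
    mu_I and nu_I, tested on all 1-Lipschitz functions, satisfies
    b_I <= |d_I| + (weighted mean of b over the two children) / 2.  Hence, on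
    the tree of intervals all of whose ancestors have 1/M <= p <= M, the sum of
    mu(I) b_I^2 is at most 4 times the sum of mu(I) d_I^2 plus 1, and the latter
    sum is bounded by L^2 orthogonality of the stopped nu-martingale p.
    Moreover inf p > 0 mu-almost everywhere and sup p < oo nu-almost everywhere.

    (b) Testing alpha(I) and alpha(I_-) on tent functions supported in I_- gives
    |d_I| <= K (alpha(I) + mu(I_-)/mu(I) alpha(I_-)).  Under mu the mean
    increment of log(1 + p) over I is at most C^2 d_I^2, so stopping when the
    sum of alpha^2 exceeds N or p exceeds M shows
    mu{S^2 <= N, sup p > M} <= B_N / log(1 + M).  Where sup p <= M, a nu-null
    set is mu-null, by outer regularity. *)

Require Import Defs.
From HB Require Import structures.
From mathcomp Require Import all_boot all_order all_algebra.
From mathcomp Require Import all_classical all_reals all_analysis.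
From mathcomp Require Import measurable_realfun ring lra.
Set Implicit Arguments. Unset Strict Implicit. Unset Printing Implicit Defensive.
Import Order.TTheory GRing.Theory Num.Theory.
Import numFieldNormedType.Exports.
Local Open Scope classical_set_scope.
Local Open Scope ring_scope.

(** * Masses and path sums on the dyadic tree *)

Section dyadic_tree.
Context {R : realType}.
Implicit Types (m n w a : nat -> nat -> R) (b : nat -> nat -> bool).

Lemma expn2S_half k j : (j < 2 ^ k.+1)%N -> (j./2 < 2 ^ k)%N.
Proof. by move=> jk; rewrite ltn_half_double -mul2n -expnS. Qed.

Lemma expn2S_double k j : (j < 2 ^ k)%N -> (j.*2 < 2 ^ k.+1)%N.
Proof. by move=> jk; rewrite expnS mul2n ltn_double. Qed.

Lemma expn2S_doubleS k j : (j < 2 ^ k)%N -> (j.*2.+1 < 2 ^ k.+1)%N.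
Proof. by move=> jk; rewrite expnS mul2n ltn_Sdouble. Qed.

Lemma level_sumS k (F : nat -> R) :
  \sum_(j < 2 ^ k.+1) F j = \sum_(j < 2 ^ k) (F j.*2 + F j.*2.+1).
Proof.
rewrite expnS mul2n; elim: (2 ^ k)%N => [|N IH]; first by rewrite !big_ord0.
by rewrite doubleS !big_ord_recr /= IH addrA.
Qed.

(* The node (k, j) stands for I_{k,j}: its parent is (k.-1, j./2) and its
   children are (k.+1, j.*2) and (k.+1, j.*2.+1). *)
Fixpoint path_sum w k j : R :=
  if k is k'.+1 then path_sum w k' j./2 + w k j else w 0%N j.

Fixpoint ever b k j : bool :=
  if k is k'.+1 then ever b k' j./2 || b k j else b 0%N j.

(** Closure under passing to children makes the sets covered at level K increase with K, so that
    bounds uniform in K pass to the union. *)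
Definition hereditary b := forall k j, b k j./2 -> b k.+1 j.

Lemma ever_hereditary b : hereditary (ever b).
Proof. by move=> k j /= ->. Qed.

Lemma everP b k j : b k j -> ever b k j.
Proof. by case: k => //= k ->; rewrite orbT. Qed.

Definition tree_measure m :=
  [/\ forall k j, 0 <= m k j, m 0%N 0%N = 1
    & forall k j, m k j = m k.+1 j.*2 + m k.+1 j.*2.+1].

Definition tree_doubling (C : R) n :=
  forall k j, (j < 2 ^ k.+1)%N -> n k j./2 <= C * n k.+1 j.

(* Meaningless when m k j = 0 (x / 0 = 0); it only occurs weighted by m k j. *)
Definition split_dev m n k j : R :=
  m k.+1 j.*2 / m k j - n k.+1 j.*2 / n k j.

Lemma level_mass m k : tree_measure m -> \sum_(j < 2 ^ k) m k j = 1.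
Proof.
case=> _ m00 mS; elim: k => [|k IH]; first by rewrite expn0 big_ord1.
by rewrite (level_sumS k (m k.+1)) -IH; apply: eq_bigr => j _; rewrite -mS.
Qed.

Lemma level_sum_le m w k c : tree_measure m ->
  (forall j, (j < 2 ^ k)%N -> w k j <= c) ->
  \sum_(j < 2 ^ k) m k j * w k j <= c.
Proof.
move=> tm wc; rewrite -[leRHS]mul1r -(level_mass k tm) mulr_suml.
by apply: ler_sum => j _; case: tm => m0 _ _; rewrite ler_wpM2l ?wc.
Qed.

Lemma ever_double b k j :
  (ever b k.+1 j.*2 = ever b k j || b k.+1 j.*2) *
  (ever b k.+1 j.*2.+1 = ever b k j || b k.+1 j.*2.+1).
Proof. by rewrite /= uphalf_double doubleK. Qed.

(** The mass of a node is the total mass of its descendants at level K, so a weighted sum over the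
    tree is the integral over level K of the sums along paths. *)
Lemma sum_path_sum m w K : tree_measure m ->
  \sum_(k < K.+1) \sum_(j < 2 ^ k) m k j * w k j =
  \sum_(j < 2 ^ K) m K j * path_sum w K j.
Proof.
move=> tm; elim: K => [|K IH]; first by rewrite big_ord1.
rewrite big_ord_recr/= IH (level_sumS K (fun j => m K.+1 j * w K.+1 j)).
rewrite (level_sumS K (fun j => m K.+1 j * path_sum w K.+1 j)) -big_split/=.
apply: eq_bigr => j _; case: tm => _ _ mS.
rewrite (mS K j) uphalf_double doubleK; ring.
Qed.

Lemma path_sum_ge0 w k j : (forall i l, 0 <= w i l) -> 0 <= path_sum w k j.
Proof. by move=> w0; elim: k j => //= k IH j; rewrite addr_ge0. Qed.

Lemma ler_path_sum w w' k j : (forall i l, w i l <= w' i l) ->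
  path_sum w k j <= path_sum w' k j.
Proof. by move=> ww'; elim: k j => //= k IH j; rewrite lerD. Qed.

(** A weak-type maximal inequality: the nodes where [b] first holds on a path are disjoint, and
    [m <= c * n] on each of them. *)
Lemma ever_mass_le m n b c K : tree_measure m -> tree_measure n -> 0 <= c ->
  (forall k j, (j < 2 ^ k)%N -> b k j -> m k j <= c * n k j) ->
  \sum_(j < 2 ^ K) m K j * (ever b K j)%:R <=
  c * \sum_(j < 2 ^ K) n K j * (ever b K j)%:R.
Proof.
move=> [m0 m00 mS] [n0 n00 nS] c0 bmn; elim: K => [|K IH].
  rewrite expn0 !big_ord1/=; case: (boolP (b 0%N 0%N)) => /= b00; last by rewrite !mulr0.
  by rewrite !mulr1 bmn.
rewrite (level_sumS K (fun j => m K.+1 j * (ever b K.+1 j)%:R)).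
rewrite (level_sumS K (fun j => n K.+1 j * (ever b K.+1 j)%:R)).
pose e j : R := (ever b K j)%:R.
(* The surplus of c n over m on the marked nodes does not decrease with K: marked nodes hand theirs
   down, and newly marked ones add a nonnegative amount. *)
rewrite -subr_ge0; move: IH; rewrite -subr_ge0 => /le_trans; apply.
rewrite !mulr_sumr -!sumrB; apply: ler_sum => j _.
rewrite !ever_double (mS K j) (nS K j).
have b1 := bmn K.+1 j.*2 (expn2S_double (ltn_ord j)).
have b2 := bmn K.+1 j.*2.+1 (expn2S_doubleS (ltn_ord j)).
case: (ever b K j) => /=; first by rewrite !mulr1 mulrDr; lra.
rewrite !mulr0 subrr.
case: (b K.+1 j.*2) b1 => [/(_ isT)|_]; case: (b K.+1 j.*2.+1) b2 => [/(_ isT)|_];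
  rewrite /= ?mulr1 ?mulr0; lra.
Qed.

(** Under doubling a child of mass 0 would force mass 0 on its parent, while the root has mass 1. *)
Lemma tree_doubling_gt0 C n : tree_measure n -> tree_doubling C n ->
  forall k j, (j < 2 ^ k)%N -> 0 < n k j.
Proof.
move=> [n0 n00 nS] dn; elim=> [|k IH] j jk.
  by move: jk; rewrite expn0 ltnS leqn0 => /eqP ->; rewrite n00.
have := lt_le_trans (IH _ (expn2S_half jk)) (dn _ _ jk).
by move=> Cn; rewrite lt_neqAle n0 andbT; case: eqP Cn => // <-; rewrite mulr0 ltxx.
Qed.

End dyadic_tree.

(** * Splitting one interval: energy and logarithm *)

Section one_step.
Context {R : realType}.

(** Here m^2/n is the integral against n of the squared density p = m/n. The last term is the exact
    gain in passing to the children: the square of the martingale increment. *)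
Lemma split_energyE (m1 m2 n1 n2 : R) : 0 < n1 -> 0 < n2 -> 0 < m1 + m2 ->
  m1 ^+ 2 / n1 + m2 ^+ 2 / n2 =
  (m1 + m2) ^+ 2 / (n1 + n2) +
  (m1 + m2) ^+ 2 * (m1 / (m1 + m2) - n1 / (n1 + n2)) ^+ 2 * (n1 + n2) / (n1 * n2).
Proof.
move=> n10 n20 m0; have n0 : 0 < n1 + n2 by rewrite addr_gt0.
by field; rewrite !gt_eqF.
Qed.

Lemma split_energy_ge (m1 m2 n1 n2 : R) : 0 < n1 -> 0 < n2 -> 0 < m1 + m2 ->
  (m1 + m2) ^+ 2 / (n1 + n2) +
  (m1 + m2) ^+ 2 / (n1 + n2) * (m1 / (m1 + m2) - n1 / (n1 + n2)) ^+ 2 <=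
  m1 ^+ 2 / n1 + m2 ^+ 2 / n2.
Proof.
move=> n10 n20 m0; have n0 : 0 < n1 + n2 by rewrite addr_gt0.
rewrite split_energyE// lerD2l mulrAC -[leRHS]mulrA.
apply: ler_wpM2l; first by rewrite mulr_ge0// sqr_ge0.
by rewrite ler_pdivlMr ?mulr_gt0// mulrC ler_pdivrMr//; nra.
Qed.

Lemma ln1D_le_tangent (x y : R) : 0 <= x -> 0 <= y ->
  ln (1 + y) <= ln (1 + x) + (y - x) / (1 + x).
Proof.
move=> x0 y0; have x1 : 0 < 1 + x by lra.
have y1 : 0 < 1 + y by lra.
rewrite -lerBlDl -ln_div ?posrE//.
have -> : (1 + y) / (1 + x) = 1 + (y - x) / (1 + x) by field; rewrite gt_eqF.
apply: le_ln1Dx.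
rewrite ltr_pdivlMr//; lra.
Qed.

(** Both logarithms are bounded by the tangent at the parent density p. What remains is the energy
    gain divided by 1 + p; doubling bounds n^2/(n1 n2) by C^2, and p/(1 + p) <= 1. *)
Lemma split_ln_le (m1 m2 n1 n2 C : R) : 0 <= m1 -> 0 <= m2 -> 0 < n1 -> 0 < n2 ->
  0 < C -> n1 + n2 <= C * n1 -> n1 + n2 <= C * n2 ->
  m1 * ln (1 + m1 / n1) + m2 * ln (1 + m2 / n2) <=
  (m1 + m2) * ln (1 + (m1 + m2) / (n1 + n2)) +
  C ^+ 2 * ((m1 + m2) * (m1 / (m1 + m2) - n1 / (n1 + n2)) ^+ 2).
Proof.
move=> m10 m20 n10 n20 C0 d1 d2.
have n0 : 0 < n1 + n2 by rewrite addr_gt0.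
have := addr_ge0 m10 m20; rewrite le_eqVlt => /predU1P[/esym m0|m0].
  have -> : m1 = 0 by lra.
  have -> : m2 = 0 by lra.
  by rewrite addr0 !mul0r mulr0 addr0.
set p := (m1 + m2) / (n1 + n2); set d := _ - _.
have p0 : 0 < p by rewrite divr_gt0.
have t1 := @ln1D_le_tangent p (m1 / n1) (ltW p0) (divr_ge0 m10 (ltW n10)).
have t2 := @ln1D_le_tangent p (m2 / n2) (ltW p0) (divr_ge0 m20 (ltW n20)).
apply: (le_trans (lerD (ler_wpM2l m10 t1) (ler_wpM2l m20 t2))).
rewrite !mulrDr addrACA -mulrDl lerD2l.
(* The linear terms have mean zero under n but not under m; their m-mean is the energy gain over 1 +
   p. *)
have -> : m1 * ((m1 / n1 - p) / (1 + p)) + m2 * ((m2 / n2 - p) / (1 + p)) =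
   (m1 ^+ 2 / n1 + m2 ^+ 2 / n2 - (m1 + m2) ^+ 2 / (n1 + n2)) / (1 + p).
  by rewrite /p; field; rewrite !gt_eqF// addrC addr_gt0//; nra.
rewrite split_energyE// (addrC (_ / (n1 + n2))) addrK -/d.
have -> : (m1 + m2) ^+ 2 * d ^+ 2 * (n1 + n2) / (n1 * n2) =
   (m1 + m2) * d ^+ 2 * ((n1 + n2) ^+ 2 / (n1 * n2)) * p.
  by rewrite /p; field; rewrite !gt_eqF.
have q2 : (n1 + n2) ^+ 2 / (n1 * n2) <= C ^+ 2.
  by rewrite ler_pdivrMr ?mulr_gt0//; nra.
have d0 : 0 <= (m1 + m2) * d ^+ 2 by rewrite mulr_ge0 ?sqr_ge0// ltW.
rewrite ler_pdivrMr; last by lra.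
have := ler_wpM2l d0 q2.
set X := _ * (_ / _); set Y := _ * d ^+ 2 => XY.
have X0 : 0 <= X by rewrite mulr_ge0// divr_ge0// ?sqr_ge0// ltW// mulr_gt0.
apply: (@le_trans _ _ (Y * C ^+ 2 * p)); first by rewrite ler_wpM2r// ltW.
rewrite [C ^+ 2 * _]mulrC ler_wpM2l//; first exact: le_trans XY.
lra.
Qed.

End one_step.

(** * Stopping-time estimates *)

(** Squaring the recursion leaves coefficient 2 on the parent against 1 on the children, so one copy
    of the parent term survives when the inequality is telescoped down the tree. *)
Lemma convex_sq_le (R : realType) (x x1 x2 b b1 b2 D : R) :
  0 < x -> 0 <= x1 -> 0 <= x2 -> x = x1 + x2 -> 0 <= D -> 0 <= b ->
  x * b <= x * D + 2^-1 * (x1 * b1 + x2 * b2) ->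
  2 * (x * b ^+ 2) <= 4 * (x * D ^+ 2) + (x1 * b1 ^+ 2 + x2 * b2 ^+ 2).
Proof.
move=> x0 x10 x20 xE D0 b0 H.
set S := x1 * b1 + x2 * b2 in H *; set Q := x1 * b1 ^+ 2 + x2 * b2 ^+ 2.
(* Cauchy-Schwarz *)
have CS : S ^+ 2 <= x * Q.
  have -> : x * Q = S ^+ 2 + x1 * x2 * (b1 - b2) ^+ 2 by rewrite /S /Q xE; ring.
  by rewrite lerDl mulr_ge0 ?sqr_ge0// mulr_ge0.
rewrite -(ler_pM2l x0).
have H2 : (x * b) ^+ 2 <= (x * D + 2^-1 * S) ^+ 2.
  have xb0 : 0 <= x * b by rewrite mulr_ge0// ltW.
  by rewrite ler_sqr// nnegrE// (le_trans xb0).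
(* This gives (X + Y)^2 <= 2 X^2 + 2 Y^2. *)
have H3 := sqr_ge0 (x * D - 2^-1 * S).
nra.
Qed.

Section stopping.
Context {R : realType}.
Variables (C : R) (m n : nat -> nat -> R).
Hypotheses (tm : tree_measure m) (tn : tree_measure n).
Hypotheses (C1 : 1 <= C) (dn : tree_doubling C n).

Let m_ge0 k j : 0 <= m k j. Proof. by case: tm. Qed.
Let mS k j : m k j = m k.+1 j.*2 + m k.+1 j.*2.+1. Proof. by case: tm. Qed.
Let nS k j : n k j = n k.+1 j.*2 + n k.+1 j.*2.+1. Proof. by case: tn. Qed.
Let n_gt0 k j : (j < 2 ^ k)%N -> 0 < n k j. Proof. exact: (tree_doubling_gt0 tn dn). Qed.

Let children k j : (j < 2 ^ k)%N ->
  [/\ 0 < n k.+1 j.*2, 0 < n k.+1 j.*2.+1,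
     n k j <= C * n k.+1 j.*2 & n k j <= C * n k.+1 j.*2.+1].
Proof.
move=> jk; have jk1 := expn2S_double jk; have jk2 := expn2S_doubleS jk.
split; [exact: n_gt0|exact: n_gt0| |].
- by have := dn jk1; rewrite doubleK.
- by have := dn jk2; rewrite /= uphalf_double.
Qed.

(* Telescoping of the integrals over level k of a potential v. *)
Lemma potential_step (c : R) (v : nat -> nat -> R) (f : nat -> nat -> R) :
  (forall k j, (j < 2 ^ k)%N ->
    m k j * v k j + f k j <=
    m k.+1 j.*2 * v k.+1 j.*2 + m k.+1 j.*2.+1 * v k.+1 j.*2.+1) ->
  0 <= v 0%N 0%N -> (forall k j, (j < 2 ^ k)%N -> v k j <= c) ->
  forall K, \sum_(k < K) \sum_(j < 2 ^ k) f k j <= c.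
Proof.
move=> step v0 vc K.
suff H : \sum_(k < K) \sum_(j < 2 ^ k) f k j <= \sum_(j < 2 ^ K) m K j * v K j.
  exact: (le_trans H (level_sum_le tm (vc K))).
elim: K => [|K IH]; first by rewrite big_ord0 expn0 big_ord1 mulr_ge0.
rewrite big_ord_recr (level_sumS K (fun j => m K.+1 j * v K.+1 j)).
apply: (le_trans (lerD IH (lexx _))); rewrite -big_split/=.
by apply: ler_sum => j _; apply: step.
Qed.

(** * Square sums while the density stays between 1/M and M *)

Section density_bounds.
Variables (M : R) (M1 : 1 <= M).

(** Written without division, so that a node with m = 0 < n counts as an exit; nodes not yet stopped
    therefore have positive m. *)
Definition density_out k j := (M * m k j < n k j) || (M * n k j < m k j).

Let T k j := ~~ ever density_out k j.

(** Orthogonality of the stopped density: the potential [v] is p before the exit and the constant C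
    M afterwards. Each step before the exit raises its m-integral by at least p m d^2 >= m d^2 / M,
    and [v] never exceeds C M. *)
Lemma deviation_sum_le K :
  \sum_(k < K) \sum_(j < 2 ^ k) (T k j)%:R * m k j * split_dev m n k j ^+ 2
  <= C * M ^+ 2.
Proof.
have M0 : 0 < M by apply: lt_le_trans M1.
have C0 : 0 < C by apply: lt_le_trans C1.
pose v k j : R := if T k j then m k j / n k j else C * M.
pose f k j : R := (T k j)%:R * m k j * split_dev m n k j ^+ 2 / M.
have Tle k j : (j < 2 ^ k)%N -> T k j ->
    n k j <= M * m k j /\ m k j <= M * n k j.
  move=> jk; rewrite /T => Tkj; have : ~~ density_out k j.
    by apply: contra Tkj => /everP.
  by rewrite /density_out negb_or -!leNgt => /andP[].
suff : \sum_(k < K) \sum_(j < 2 ^ k) f k j <= C * M.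
  rewrite -(ler_pM2r M0) => /le_trans; move=> H; have := H _ (lexx _).
  rewrite mulr_suml expr2 mulrA; apply: le_trans.
  apply: ler_sum => k _; rewrite mulr_suml; apply: ler_sum => j _.
  by rewrite /f divfK// gt_eqF.
apply: (@potential_step _ v f).
- move=> k j jk; have [n1 n2 d1 d2] := children jk.
  rewrite /v /f; case: (boolP (T k j)) => [Tk|nTk]; last first.
    have -> : T k.+1 j.*2 = false.
      by apply/negbTE; move: nTk; rewrite /T !negbK ever_double => ->.
    have -> : T k.+1 j.*2.+1 = false.
      by apply/negbTE; move: nTk; rewrite /T !negbK ever_double => ->.
    by rewrite /= !mul0r addr0 (mS k j) mulrDl.
  have [nm mn] := Tle _ _ jk Tk; have nk := n_gt0 jk.
  have mk : 0 < m k j by rewrite -(pmulr_rgt0 _ M0); apply: lt_le_trans nm.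
  have := @split_energy_ge _ (m k.+1 j.*2) (m k.+1 j.*2.+1) _ _ n1 n2.
  rewrite -mS -nS => /(_ mk); rewrite -/(split_dev m n k j).
  set d := split_dev m n k j => E.
  (* Freezing the potential does not lower it: a child of a running node has m at most that of its
     parent, hence p <= C M by doubling. *)
  have cl i : 0 < n k.+1 i -> n k j <= C * n k.+1 i -> m k.+1 i <= m k j ->
     m k.+1 i ^+ 2 / n k.+1 i <=
     m k.+1 i * (if T k.+1 i then m k.+1 i / n k.+1 i else C * M).
    move=> ni ci mi; rewrite expr2 -mulrA; case: ifP => // _.
    rewrite ler_wpM2l// ler_pdivrMr//; apply: (le_trans mi); apply: (le_trans mn).
    by rewrite mulrC mulrAC ler_wpM2r// ltW.
  have m1 : m k.+1 j.*2 <= m k j by rewrite (mS k j) lerDl.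
  have m2 : m k.+1 j.*2.+1 <= m k j by rewrite (mS k j) lerDr.
  apply: le_trans (lerD (cl _ n1 d1 m1) (cl _ n2 d2 m2)); apply: le_trans E.
  have -> : m k j * (m k j / n k j) = m k j ^+ 2 / n k j by rewrite mulrA expr2.
  rewrite lerD2l mul1r mulrAC; apply: ler_wpM2r; first exact: sqr_ge0.
  by rewrite expr2 -mulrA ler_wpM2l// ler_pdivlMr// ler_pdivrMl.
- by rewrite /v; case: ifP => _; [rewrite divr_ge0// ltW// n_gt0|rewrite mulr_ge0 ?ltW].
- move=> k j jk; rewrite /v; case: ifP => // /(Tle _ _ jk)[_].
  rewrite -ler_pdivrMr ?n_gt0// => /le_trans; apply.
  by rewrite ler_peMl// ltW.
Qed.

(** The potential is beta^2 before the exit and 1 afterwards. By [convex_sq_le] the sum of m beta^2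
    - 4 m d^2 telescopes to at most 1, and [deviation_sum_le] bounds the sum of m d^2. *)
Lemma energy_sum_le (beta : nat -> nat -> R) :
  (forall k j, 0 <= beta k j <= 1) ->
  (forall k j, (j < 2 ^ k)%N -> 0 < m k j ->
    m k j * beta k j <= m k j * `|split_dev m n k j| +
     2^-1 * (m k.+1 j.*2 * beta k.+1 j.*2 + m k.+1 j.*2.+1 * beta k.+1 j.*2.+1)) ->
  forall K,
  \sum_(k < K) \sum_(j < 2 ^ k) (T k j)%:R * m k j * beta k j ^+ 2
  <= 4 * C * M ^+ 2 + 1.
Proof.
move=> b01 brec K.
have M0 : 0 < M by apply: lt_le_trans M1.
pose d := split_dev m n.
pose v k j : R := if T k j then beta k j ^+ 2 else 1.
pose f k j : R := (T k j)%:R * m k j * beta k j ^+ 2 -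
  4 * ((T k j)%:R * m k j * d k j ^+ 2).
have := deviation_sum_le K; rewrite -/d => E.
suff : \sum_(k < K) \sum_(j < 2 ^ k) f k j <= 1.
  have -> : \sum_(k < K) \sum_(j < 2 ^ k) f k j =
     \sum_(k < K) \sum_(j < 2 ^ k) (T k j)%:R * m k j * beta k j ^+ 2 -
     4 * \sum_(k < K) \sum_(j < 2 ^ k) (T k j)%:R * m k j * d k j ^+ 2.
    rewrite mulr_sumr -sumrB; apply: eq_bigr => k _.
    by rewrite mulr_sumr -sumrB.
  lra.
have bb k j : 0 <= beta k j ^+ 2 <= 1.
  by have /andP[b0 b1] := b01 k j; rewrite sqr_ge0/= expr_le1.
apply: (@potential_step _ v f).
- move=> k j jk; rewrite /v /f; case: (boolP (T k j)) => [Tk|nTk]; last first.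
    have -> : T k.+1 j.*2 = false.
      by apply/negbTE; move: nTk; rewrite /T !negbK ever_double => ->.
    have -> : T k.+1 j.*2.+1 = false.
      by apply/negbTE; move: nTk; rewrite /T !negbK ever_double => ->.
    rewrite /= !mul0r; have := mS k j; lra.
  have nk := n_gt0 jk.
  have mk : 0 < m k j.
    rewrite -(pmulr_rgt0 _ M0); apply: lt_le_trans nk _.
    by move: Tk; rewrite /T; apply: contraNT; rewrite -ltNge => h; apply: everP; rewrite /density_out h.
  have := brec _ _ jk mk; rewrite -/(d k j) => B.
  set v1 := if T k.+1 _ then _ else _; set v2 := if T k.+1 _ then _ else _.
  have V1 : beta k.+1 j.*2 ^+ 2 <= v1 by rewrite /v1; case: ifP => // _; have /andP[] := bb k.+1 j.*2.
  have V2 : beta k.+1 j.*2.+1 ^+ 2 <= v2 by rewrite /v2; case: ifP => // _; have /andP[] := bb k.+1 j.*2.+1.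
  apply: le_trans (lerD (ler_wpM2l (m_ge0 _ _) V1) (ler_wpM2l (m_ge0 _ _) V2)).
  have := m_ge0 k.+1 j.*2; have := m_ge0 k.+1 j.*2.+1; have := mS k j.
  have /andP[] := b01 k j; have /andP[] := b01 k.+1 j.*2; have /andP[] := b01 k.+1 j.*2.+1.
  have := real_normK (num_real (d k j)); move: B; have := normr_ge0 (d k j).
  move: `|d k j| => D; move: (d k j ^+ 2) => D2.
  move=> D0 B D2E b20 b21 b10 b11 b0 b1 mE m20 m10; rewrite mul1r -D2E.
  by have := convex_sq_le mk m10 m20 mE D0 b0 B; lra.
- by rewrite /v; case: ifP => // _; have /andP[] := bb 0%N 0%N.
- by move=> k j jk; rewrite /v; case: ifP => // _; have /andP[] := bb k j.
Qed.
End density_bounds.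
End stopping.

(** * Stopping by the sum of squares, and the logarithmic potential *)

Section singular_stopping.
Context {R : realType}.
Variables (C D : R) (m n a : nat -> nat -> R).
Hypotheses (tm : tree_measure m) (tn : tree_measure n).
Hypotheses (C1 : 1 <= C) (dn : tree_doubling C n).
Hypotheses (a01 : forall k j, 0 <= a k j <= 1).
Hypothesis dev_le : forall k j, (j < 2 ^ k)%N -> 0 < m k j ->
  m k j * `|split_dev m n k j| <= D * (m k j * a k j + m k.+1 j.*2 * a k.+1 j.*2).
Variables (M N : R).
Hypotheses (M1 : 1 <= M) (N1 : 1 <= N).

Let m_ge0 k j : 0 <= m k j. Proof. by case: tm. Qed.
Let mS k j : m k j = m k.+1 j.*2 + m k.+1 j.*2.+1. Proof. by case: tm. Qed.
Let nS k j : n k j = n k.+1 j.*2 + n k.+1 j.*2.+1. Proof. by case: tn. Qed.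
Let n_gt0 k j : (j < 2 ^ k)%N -> 0 < n k j. Proof. exact: (tree_doubling_gt0 tn dn). Qed.

Let S := path_sum (fun k j => a k j ^+ 2).

Let S_parent k j : S k j./2 <= S k.+1 j.
Proof. by rewrite /S /= lerDl sqr_ge0. Qed.

(** The event to be estimated. Since [S] increases along paths, no such exit can occur below a node
    where [S] exceeds N. *)
Definition dense_exit k j := (M * n k j < m k j) && (S k j <= N).

Let stop k j := (M * n k j < m k j) || (N < S k j).
Let U k j := ~~ ever stop k j.

Let U_sum k j : U k j -> S k j <= N.
Proof. by apply: contraNT; rewrite -ltNge => NS; apply: everP; rewrite /stop NS orbT. Qed.

(* The path to (k, j) is not yet stopped iff U k j; it stops either at a
   [dense_exit] or because the running sum of squares has exceeded N. *)
Let U_exit k j : U k j -> ever dense_exit k j = false.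
Proof.
move=> Uk; apply/negbTE; apply: contra Uk; elim: k j => [|k IH] j /=.
  by rewrite /dense_exit /stop => /andP[->].
by rewrite /dense_exit /stop => /orP[/IH ->//|/andP[-> _]]; rewrite orbT.
Qed.

Let stop_exit k j : ~~ U k j -> ever dense_exit k j \/ N < S k j.
Proof.
rewrite negbK; elim: k j => [|k IH] j /=.
  by rewrite /stop /dense_exit; case: (ltP N (S 0 j)); [right|case: (_ < _) => //; left].
case: (ltP N (S k.+1 j)) => [NS|SN]; first by right.
have SkN : (N < S k j./2) = false.
  by apply/negbTE; rewrite -leNgt (le_trans (S_parent _ _)).
have -> : stop k.+1 j = (M * n k.+1 j < m k.+1 j) by rewrite /stop [N < _]ltNge SN orbF.
have -> : dense_exit k.+1 j = (M * n k.+1 j < m k.+1 j) by rewrite /dense_exit SN andbT.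
by move=> /orP[/IH[->|]|->]; rewrite ?orbT ?SkN//; left.
Qed.

(** The cutoff is read at the parent because the deviation at a running node involves [a] at a
    child, which may already be stopped. *)
Let w k j : R := if k is k'.+1 then (U k' j./2)%:R * a k j ^+ 2 else a k j ^+ 2.

Let sq01 k j : 0 <= a k j ^+ 2 <= 1.
Proof. by have /andP[b0 b1] := a01 k j; rewrite sqr_ge0/= expr_le1. Qed.

Let w_le k j : 0 <= w k j <= a k j ^+ 2.
Proof.
have /andP[a0 _] := sq01 k j; rewrite /w; case: k a0 => [|k] a0; first by rewrite a0 lexx.
by case: (U _ _); rewrite /= ?mul1r ?mul0r ?a0 ?lexx.
Qed.

(** The sum is at most N up to the last running node; the next term overshoots by at most 1, and all
    later terms vanish. *)
Let path_w_le k j : path_sum w k j <= N + 1.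
Proof.
elim: k j => [|k IH] j /=; first by have /andP[_ h] := sq01 0 j; apply: (le_trans h); rewrite lerDr (le_trans ler01).
case: (boolP (U k j./2)) => Uk; last by rewrite /= mul0r addr0.
have := U_sum Uk; have : path_sum w k j./2 <= S k j./2.
  by apply: ler_path_sum => i l; have /andP[] := w_le i l.
by rewrite /= mul1r; have /andP[] := sq01 k.+1 j; lra.
Qed.

(** Squaring [dev_le] gives m d^2 <= 2 D^2 times the parent and child terms; the sums of either kind
    are at most N + 1. *)
Lemma deviation_sum_alpha_le K :
  \sum_(k < K) \sum_(j < 2 ^ k) (U k j)%:R * m k j * split_dev m n k j ^+ 2
  <= 4 * D ^+ 2 * (N + 1).
Proof.
have W : \sum_(k < K.+1) \sum_(j < 2 ^ k) m k j * w k j <= N + 1.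
  by rewrite sum_path_sum//; apply: level_sum_le.
pose s k := \sum_(j < 2 ^ k) m k j * w k j.
have s0 k : 0 <= s k by apply: sumr_ge0 => j _; rewrite mulr_ge0//; have /andP[] := w_le k j.
have W1 : \sum_(k < K) s k <= N + 1.
  by apply: le_trans W; rewrite big_ord_recr/= lerDl; apply: s0.
have W2 : \sum_(k < K) s k.+1 <= N + 1.
  by apply: le_trans W; rewrite big_ord_recl/= lerDr; apply: s0.
have step k : \sum_(j < 2 ^ k) (U k j)%:R * m k j * split_dev m n k j ^+ 2 <=
    2 * D ^+ 2 * (s k + s k.+1).
  rewrite /s (level_sumS k (fun j => m k.+1 j * w k.+1 j)) -big_split/= mulr_sumr.
  apply: ler_sum => j _; rewrite doubleK uphalf_double.
  have w0 : 0 <= m k j * w k j by rewrite mulr_ge0//; have /andP[] := w_le k j.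
  have /andP[a10 a11] := sq01 k.+1 j.*2; have /andP[a20 a21] := sq01 k.+1 j.*2.+1.
  have D2 : 0 <= 2 * D ^+ 2 by rewrite mulr_ge0// sqr_ge0.
  case: (boolP (U k j)) => Uk; last first.
    by rewrite /= !mul0r !mulr0 !addr0 mulr_ge0.
  rewrite !mul1r.
  (* The parent of a running node is running, so the cutoff is 1 here. *)
  have -> : w k j = a k j ^+ 2.
    move: Uk; rewrite /w; case: k {w0 a10 a11 a20 a21} j => // k j.
    rewrite /U /= negb_or => /andP[-> _].
    by rewrite mul1r.
  have := m_ge0 k j; rewrite le_eqVlt => /predU1P[m0|mk].
    by rewrite -m0 !mul0r add0r mulr_ge0// addr_ge0// mulr_ge0.
  have := dev_le (ltn_ord j) mk; set d := split_dev _ _ _ _; rewrite -(real_normK (num_real d)).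
  move: (normr_ge0 d); move: `|d| => {}d d0 H.
  have m1 := m_ge0 k.+1 j.*2; have m2 := m_ge0 k.+1 j.*2.+1; have mE := mS k j.
  apply: (@le_trans _ _ (2 * D ^+ 2 * (m k j * a k j ^+ 2 + m k.+1 j.*2 * a k.+1 j.*2 ^+ 2))); last first.
    by rewrite ler_wpM2l// lerD2l lerDl mulr_ge0.
  have /andP[b0 _] := a01 k j; have /andP[b1 _] := a01 k.+1 j.*2.
  move: (a k j) (a k.+1 j.*2) b0 b1 H {a10 a11 a20 a21 w0} => x y x0 y0 H.
  move: (m k j) (m k.+1 j.*2) (m k.+1 j.*2.+1) mk m1 m2 mE H => p p1 p2 p0 p10 p20 pE H.
  have H2 : (p * d) ^+ 2 <= (D * (p * x + p1 * y)) ^+ 2.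
    have pd0 : 0 <= p * d by rewrite mulr_ge0// ltW.
    by rewrite ler_sqr// nnegrE// (le_trans pd0).
  rewrite -(ler_pM2l p0).
  have -> : p * (p * d ^+ 2) = (p * d) ^+ 2 by ring.
  apply: (le_trans H2); rewrite exprMn.
  have -> : p * (2 * D ^+ 2 * (p * x ^+ 2 + p1 * y ^+ 2)) =
     D ^+ 2 * (2 * p * (p * x ^+ 2 + p1 * y ^+ 2)) by ring.
  rewrite ler_wpM2l ?sqr_ge0//.
  (* The inequality (u + v)^2 <= 2 u^2 + 2 v^2 with u = p x and v = p1 y, its defect written out;
     the child mass p1 is p - p2. *)
  have -> : 2 * p * (p * x ^+ 2 + p1 * y ^+ 2) = (p * x + p1 * y) ^+ 2 +
    ((p * x - p1 * y) ^+ 2 + 2 * (p1 * p2) * y ^+ 2) by rewrite pE; ring.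
  by rewrite lerDl addr_ge0 ?sqr_ge0// mulr_ge0 ?sqr_ge0// mulr_ge0// mulr_ge0.
apply: (@le_trans _ _ (\sum_(k < K) 2 * D ^+ 2 * (s k + s k.+1))).
  by apply: ler_sum => k _; apply: step.
rewrite -mulr_sumr big_split/=.
have -> : 4 * D ^+ 2 * (N + 1) = 2 * D ^+ 2 * ((N + 1) + (N + 1)) by ring.
by rewrite ler_wpM2l ?lerD// mulr_ge0// sqr_ge0.
Qed.

(** The potential [v] is ln(1 + p) on running paths, ln(1 + M) on paths that left by a dense exit,
    and 0 on those stopped otherwise. Its m-mean starts at most at ln 2, since p = 1 at the root,
    and grows by at most C^2 m d^2 at each running node. *)
Lemma dense_exit_mass_le K :
  ln (1 + M) * \sum_(j < 2 ^ K) m K j * (ever dense_exit K j)%:R <=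
  ln 2 + C ^+ 2 * (4 * D ^+ 2 * (N + 1)).
Proof.
have C0 : 0 < C by apply: lt_le_trans C1.
pose v k j := (ever dense_exit k j)%:R * ln (1 + M) + (U k j)%:R * ln (1 + m k j / n k j).
pose E k := \sum_(j < 2 ^ k) (U k j)%:R * m k j * split_dev m n k j ^+ 2.
have lnpos k j : (j < 2 ^ k)%N -> 0 <= ln (1 + m k j / n k j).
  by move=> jk; rewrite ln_ge0// lerDl divr_ge0// ltW// n_gt0.
have V : \sum_(j < 2 ^ K) m K j * v K j <= ln 2 + C ^+ 2 * \sum_(k < K) E k.
  elim: K => [|K IH].
    case: tm tn => _ m00 _ [_ n00 _].
    rewrite big_ord0 mulr0 addr0 expn0 big_ord1 m00 mul1r /v/=.
    rewrite /dense_exit m00 n00 mulr1 ltNge M1/= mul0r add0r divr1 -[1+1]/2.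
    by case: (U _ _); rewrite ?mul1r ?mul0r// ln_ge0// ler1n.
  rewrite big_ord_recr/= mulrDr addrA; apply: le_trans (lerD IH (lexx _)).
  rewrite (level_sumS K (fun j => m K.+1 j * v K.+1 j)) mulr_sumr -big_split/=.
  apply: ler_sum => -[j jk] _ /=.
  have jk1 := expn2S_double jk; have jk2 := expn2S_doubleS jk.
  case: (boolP (U K j)) => [Uk|nUk]; last first.
    (* Below a stopped node [v] is constant: either a dense exit is already recorded, or [S] exceeds
       N and none can follow. *)
    have cl i : i./2 = j -> v K.+1 i = v K j.
      move=> ij; rewrite /v /= ij.
      have -> : U K.+1 i = false.
        by apply/negbTE; move: nUk; rewrite /U/= ij !negbK => ->.
      rewrite (negbTE nUk) !mul0r !addr0.
      case: (stop_exit nUk) => [->//|NS].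
      rewrite /dense_exit [_ <= N]leNgt (lt_le_trans NS) ?andbF ?orbF//.
      by rewrite -ij S_parent.
    rewrite !cl ?doubleK// ?[(_.*2.+1)./2]/= ?uphalf_double// -mulrDl -mS.
    by rewrite !mul0r mulr0 addr0.
  have vk : v K j = ln (1 + m K j / n K j).
    by rewrite /v (U_exit Uk) Uk mul0r add0r mul1r.
  (* Stopping only lowers the potential: at a dense exit p > M, and otherwise it drops to 0. *)
  have cl i : (i < 2 ^ K.+1)%N -> i./2 = j -> v K.+1 i <= ln (1 + m K.+1 i / n K.+1 i).
    move=> iK ij; have n0 := n_gt0 iK; rewrite /v /=.
    rewrite {1}ij (U_exit Uk)/=; case: (boolP (U K.+1 i)) => Ui.
      have -> : dense_exit K.+1 i = false.
        by have := U_exit Ui => /=; rewrite ij (U_exit Uk).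
      by rewrite mul0r add0r mul1r.
    rewrite mul0r addr0; case: (boolP (dense_exit _ _)) => [|_]; last by rewrite mul0r lnpos.
    rewrite /dense_exit => /andP[h _]; rewrite mul1r ler_ln ?posrE//.
    - by rewrite lerD2l ler_pdivlMr// ltW.
    - by rewrite addr_gt0// (lt_le_trans _ M1).
    - by rewrite ltr_pwDl// divr_ge0// ltW.
  have H1 := cl _ jk1 (doubleK j).
  have H2 := cl _ jk2 (uphalf_double j).
  have n1 := n_gt0 jk1; have n2 := n_gt0 jk2.
  apply: (le_trans (lerD (ler_wpM2l (m_ge0 _ _) H1) (ler_wpM2l (m_ge0 _ _) H2))).
  have d1 := dn jk1; have d2 := dn jk2.
  move: d1 d2; rewrite doubleK /= uphalf_double vk mul1r /split_dev (mS K j) (nS K j).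
  by apply: split_ln_le.
have lnM : 0 <= ln (1 + M) by rewrite ln_ge0// lerDl (le_trans _ M1).
apply: (@le_trans _ _ (\sum_(j < 2 ^ K) m K j * v K j)).
  rewrite mulr_sumr; apply: ler_sum => j _.
  rewrite mulrCA ler_wpM2l// mulrC /v lerDl.
  by case: (U _ _); rewrite ?mul0r// mul1r lnpos.
apply: (le_trans V); rewrite lerD2l ler_wpM2l ?sqr_ge0//.
exact: deviation_sum_alpha_le.
Qed.

End singular_stopping.

(** * Dyadic intervals *)

Section dyadic_intervals.
Context {R : realType}.
Implicit Types (mu : probability R R) (x : R) (e : nat -> nat -> bool).

Lemma measurable_dyadic k j : measurable (dyadic k j : set R).
Proof. exact: measurable_itv. Qed.
Hint Resolve measurable_dyadic : core.

Lemma dyadicP k j x : dyadic k j x <-> (j%:R <= 2 ^+ k * x < j.+1%:R).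
Proof.
have p0 : (0 : R) < 2 ^+ k by rewrite exprn_gt0.
by rewrite /dyadic /= in_itv/= ler_pdivrMr// ltr_pdivlMr// mulrC.
Qed.

Definition dyadic_index k x : nat := Num.truncn (2 ^+ k * x).

Lemma dyadic_index_eq k j x : dyadic k j x -> dyadic_index k x = j.
Proof. by move=> /dyadicP; apply: truncn_def. Qed.

Lemma dyadic_indexP k x : 0 <= x -> dyadic k (dyadic_index k x) x.
Proof. by move=> x0; apply/dyadicP; rewrite truncn_itv// mulr_ge0// exprn_ge0. Qed.

Lemma dyadic_index_lt k x : 0 <= x < 1 -> (dyadic_index k x < 2 ^ k)%N.
Proof.
move=> /andP[x0 x1]; rewrite truncn_lt_nat ?mulr_ge0 ?exprn_ge0//.
by rewrite natrX gtr_pMr// exprn_gt0.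
Qed.

Lemma dyadic00 : dyadic 0 0 = `[0, 1[%classic :> set R.
Proof. by rewrite /dyadic expr0 !divr1. Qed.

Lemma dyadic_half k j : dyadic k.+1 j `<=` (dyadic k j./2 : set R).
Proof.
move=> x /dyadicP; rewrite exprS -mulrA => /andP[h1 h2]; apply/dyadicP.
have : j%:R < (2 : R) * (j./2.+1)%:R.
  by rewrite -natrM ltr_nat mul2n doubleS -[X in (X < _)%N]odd_double_half; case: (odd j).
have : (2 : R) * (j./2)%:R <= j%:R.
  by rewrite -natrM ler_nat mul2n -[X in (_ <= X)%N]odd_double_half leq_addl.
have : j.+1%:R <= (2 : R) * (j./2.+1)%:R.
  by rewrite -natrM ler_nat mul2n doubleS -[X in (X.+1 <= _)%N]odd_double_half; case: (odd j).
lra.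
Qed.

Lemma dyadicU k j :
  dyadic k j = dyadic k.+1 j.*2 `|` dyadic k.+1 j.*2.+1 :> set R.
Proof.
apply/seteqP; split => x; last first.
  by case=> /dyadic_half; rewrite /= ?uphalf_double ?doubleK.
move=> /dyadicP /andP[h1 h2].
have [h|h] := ltP (2 ^+ k.+1 * x) j.*2.+1%:R; [left|right]; apply/dyadicP.
  by rewrite h andbT exprS -mulrA -mul2n natrM ler_pM2l.
by rewrite h/= -doubleS -mul2n natrM exprS -mulrA ltr_pM2l.
Qed.

Lemma dyadicI k i j : i <> j -> dyadic k i `&` dyadic k j = set0 :> set R.
Proof.
move=> ij; apply/seteqP; split => // x [/dyadic_index_eq ix /dyadic_index_eq jx].
by apply: ij; rewrite -ix -jx.
Qed.

Lemma dyadic_index_half k x : 0 <= x -> (dyadic_index k.+1 x)./2 = dyadic_index k x.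
Proof.
by move=> /(dyadic_indexP k.+1)/dyadic_half/dyadic_index_eq ->.
Qed.

Lemma everN_index e K x : 0 <= x -> ever e K (dyadic_index K x) ->
  exists k, e k (dyadic_index k x).
Proof.
move=> x0; elim: K => [|K IH] /=; first by move=> h; exists 0%N.
by rewrite dyadic_index_half// => /orP[/IH //|h]; exists K.+1.
Qed.

Definition mass mu k j : R := fine (mu (dyadic k j)).

Lemma massE mu k j : (mass mu k j)%:E = mu (dyadic k j).
Proof. by rewrite /mass fineK// fin_num_measure. Qed.

Lemma mass_tree mu : mu (~` `[0, 1[%classic) = 0%E -> tree_measure (mass mu).
Proof.
move=> mu0; split.
- by move=> k j; rewrite fine_ge0.
- rewrite /mass dyadic00; have := probability_setT mu.
  have -> : mu setT = (mu `[0%R, 1%R[%classic + mu (~` `[0%R, 1%R[%classic))%E.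
    by rewrite -measureU ?setICr ?setUv//; exact: measurableC.
  by rewrite mu0 adde0 => ->.
- move=> k j; apply: EFin_inj; rewrite EFinD !massE [in LHS]dyadicU measureU//.
  by apply: dyadicI; apply/eqP; rewrite neq_ltn ltnSn.
Qed.

Lemma mass_doubling mu (C : R) :
  (forall k j : nat, (j < 2 ^ k.+1)%N ->
     (mu (dyadic k j./2) <= C%:E * mu (dyadic k.+1 j))%E) ->
  tree_doubling C (mass mu).
Proof. by move=> d k j jk; rewrite -lee_fin EFinM !massE; exact: d. Qed.

Definition dyadic_cover e K : set R :=
  \bigcup_(j < 2 ^ K) (if e K j then dyadic K j else set0).

Lemma dyadic_coverP e K x :
  dyadic_cover e K x <-> (0 <= x < 1 /\ e K (dyadic_index K x)).
Proof.
split=> [[j /= jK]|[/andP[x0 x1] ex]].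
  case: ifPn => // ej /[dup] xj /dyadic_index_eq ->; split=> //.
  move: xj => /dyadicP /andP[h1 h2].
  have p0 : (0 : R) < 2 ^+ K by rewrite exprn_gt0.
  rewrite -(pmulr_rge0 _ p0) (le_trans _ h1)//= -(ltr_pM2l p0) mulr1 (lt_le_trans h2)//.
  by rewrite -natrX ler_nat.
exists (dyadic_index K x); first by apply: dyadic_index_lt; rewrite x0 x1.
by rewrite ex; apply: dyadic_indexP.
Qed.

Lemma measurable_dyadic_cover e K : measurable (dyadic_cover e K).
Proof. by apply: bigcup_measurable => j _; case: ifP. Qed.

Lemma dyadic_cover_mass mu e K :
  mu (dyadic_cover e K) = (\sum_(j < 2 ^ K) mass mu K j * (e K j)%:R)%:E.
Proof.
rewrite /dyadic_cover bigcup_mkord.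
rewrite (measure_semi_additive_ord_I mu (F := fun j => if e K j then dyadic K j else set0)).
- rewrite -sumEFin; apply: eq_bigr => j _; rewrite EFinM massE.
  by case: (e K j); rewrite ?mule1// mule0 measure0.
- by move=> j _; case: ifP.
- apply/trivIsetP => i j _ _ /eqP/dyadicI ij.
  by case: ifP => _; case: ifP => _; rewrite ?set0I ?setI0.
- by have := measurable_dyadic_cover e K; rewrite /dyadic_cover bigcup_mkord.
Qed.

(** Turns estimates on finite levels into null sets: the covers increase with K, so by continuity
    from below their union has measure at most eps; the unions for eps = 1/(n+1) are then
    intersected. *)
Lemma negligible_of_cover mu (X : set R) :
  (forall eps : R, 0 < eps -> exists e, [/\ hereditary e,
    forall K, \sum_(j < 2 ^ K) mass mu K j * (e K j)%:R <= eps
    & forall x, X x -> 0 <= x < 1 /\ exists K, e K (dyadic_index K x)]) ->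
  mu.-negligible X.
Proof.
move=> H.
have H' n : exists Y : set R, [/\ measurable Y, X `<=` Y & (mu Y <= (n.+1%:R^-1)%:E)%E].
  have [|e [he em Xe]] := H n.+1%:R^-1; first by rewrite invr_gt0.
  have mY : measurable (\bigcup_K dyadic_cover e K).
    by apply: bigcup_measurable => K _; apply: measurable_dyadic_cover.
  exists (\bigcup_K dyadic_cover e K); split=> //.
    by move=> x /Xe[x01 [K eK]]; exists K => //; apply/dyadic_coverP.
  have cvg : mu (dyadic_cover e K) @[K --> \oo] --> mu (\bigcup_K dyadic_cover e K).
    apply: nondecreasing_cvg_mu => //; first by move=> K; apply: measurable_dyadic_cover.
    apply/nondecreasing_seqP => K; apply/subsetPset => x /dyadic_coverP[x01 eK].
    apply/dyadic_coverP; split => //; apply: he.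
    by rewrite dyadic_index_half//; case/andP: x01.
  rewrite -(cvg_lim _ cvg)//; apply: lime_le; first by apply/cvg_ex; eexists; exact: cvg.
  by apply: nearW => K; rewrite dyadic_cover_mass lee_fin.
have [Y HY] := choice H'.
exists (\bigcap_n Y n); split.
- by apply: bigcapT_measurable => n; case: (HY n).
- apply/eqP; rewrite eq_le measure_ge0 andbT; apply/lee_addgt0Pr => eps e0.
  rewrite add0e; have /ltr_add_invr[n] := e0; rewrite add0r => ne.
  apply: (@le_trans _ _ (mu (Y n))).
    apply: le_measure; rewrite ?inE; [|by case: (HY n)|by apply: bigcap_inf].
    by apply: bigcapT_measurable => i; case: (HY i).
  by have [_ _ /le_trans] := HY n; apply; rewrite lee_fin ltW.
- by move=> x Xx n _; have [_ XY _] := HY n; apply: XY.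
Qed.

End dyadic_intervals.

(** * Wasserstein distances of the normalized measures *)

Section lipschitz_averages.
Context {R : realType}.
Implicit Types (mu nu : probability R R) (psi f : R -> R).

Definition lip (L : R) f := forall x y, `|f x - f y| <= L * `|x - y|.

Lemma lip_continuous L f : lip L f -> continuous f.
Proof.
move=> Lf x; apply/cvgrPdist_lt => e e0; near=> y.
have LL : 0 < `|L| + 1 by rewrite ltr_wpDl.
apply: (le_lt_trans (Lf _ _)); apply: (@le_lt_trans _ _ ((`|L| + 1) * `|x - y|)).
  by rewrite ler_wpM2r// (le_trans (ler_norm L))// lerDl.
rewrite mulrC -ltr_pdivlMr//; near: y.
by apply: cvgr_dist_lt => //; rewrite divr_gt0.
Unshelve. all: by end_near. Qed.

Lemma lip_integrable mu k j L f : lip L f ->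
  mu.-integrable (dyadic k j) (EFin \o f).
Proof.
move=> Lf; apply: measurable_bounded_integrable.
- exact: measurable_dyadic.
- by rewrite ltey_eq fin_num_measure//; exact: measurable_dyadic.
- apply: measurable_funTS; apply: continuous_measurable_fun.
  exact: lip_continuous Lf.
- exists (`|f (j%:R / 2 ^+ k)| + `|L| * (j.+1%:R / 2 ^+ k - j%:R / 2 ^+ k)).
  split => [|y /ltW My x /=]; first exact: num_real.
  rewrite /dyadic/= in_itv/= => /andP[x1 x2].
  apply: le_trans My; rewrite -lerBlDl; apply: (le_trans (lerB_dist _ _)).
  apply: (le_trans (Lf _ _)); apply: (@le_trans _ _ (`|L| * `|x - j%:R / 2 ^+ k|)).
    by rewrite ler_wpM2r// ler_norm.
  rewrite ler_wpM2l//.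
  by rewrite ger0_norm ?subr_ge0// lerD2r ltW.
Qed.
End lipschitz_averages.

(** * Averages of Lipschitz functions and the coefficients alpha *)

Section averages.
Context {R : realType}.
Implicit Types (mu nu : probability R R) (psi : R -> R) (x : R).

(* Equal to 0 when mass mu k j = 0, in agreement with the convention mu_I = 0. *)
Definition average mu k j psi : R :=
  (\int[mu]_(x in dyadic k j) psi (Tdy k j x)) / mass mu k j.

Lemma lip_Tdy k j psi : lip 1 psi -> lip (2 ^+ k) (psi \o Tdy k j).
Proof.
move=> l x y /=; apply: (le_trans (l _ _)); rewrite mul1r /Tdy.
by rewrite opprB addrA subrK -mulrBr normrM ger0_norm// exprn_ge0.
Qed.

Lemma lip_affine (a b c : R) psi : lip 1 psi -> `|c * a| <= 1 ->
  lip 1 (fun y => c * psi (a * y + b)).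
Proof.
move=> l ca x y; rewrite -mulrBr normrM.
apply: (le_trans (ler_wpM2l (normr_ge0 c) (l _ _))).
rewrite mul1r opprD addrACA subrr addr0 -mulrBr normrM mulrA -normrM.
by rewrite ler_wpM2r.
Qed.

Lemma Tdy_itv k j x : dyadic k j x -> 0 <= (Tdy k j x : R) < 1.
Proof. by move=> /dyadicP; rewrite /Tdy -natr1; lra. Qed.

Lemma Rintegral_dyadic_itv mu k j psi (lo hi : R) : lip 1 psi ->
  (forall y, 0 <= y < 1 -> lo <= psi y <= hi) ->
  lo * mass mu k j <= \int[mu]_(x in dyadic k j) psi (Tdy k j x) <= hi * mass mu k j.
Proof.
move=> l b; have mI := @measurable_dyadic R k j.
have I := lip_integrable mu k j (lip_Tdy k j l).
have Ic c : mu.-integrable (dyadic k j) (EFin \o (fun=> c)).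
  by apply: (@lip_integrable _ mu k j 0) => x y; rewrite subrr normr0 mul0r.
rewrite /mass -!Rintegral_cst//; apply/andP; split; apply: le_Rintegral => //.
- by move=> x /Tdy_itv/b/andP[].
- by move=> x /Tdy_itv/b/andP[].
Qed.

Lemma average_itv mu k j psi (lo hi : R) : 0 < mass mu k j -> lip 1 psi ->
  (forall y, 0 <= y < 1 -> lo <= psi y <= hi) -> lo <= average mu k j psi <= hi.
Proof.
move=> m0 l /(Rintegral_dyadic_itv mu k j l).
by rewrite /average ler_pdivlMr// ler_pdivrMr.
Qed.

Lemma lip_itv psi : lip 1 psi ->
  forall y, 0 <= y < 1 -> psi 2^-1 - 2^-1 <= psi y <= psi 2^-1 + 2^-1.
Proof.
move=> l y /andP[y0 y1]; have := l y 2^-1; rewrite mul1r.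
have : `|y - 2^-1| <= 2^-1 by rewrite ler_norml; lra.
move=> h /le_trans/(_ h); rewrite ler_norml; lra.
Qed.

(** At mass 0 the integral vanishes too, because a Lipschitz function is bounded on the interval. *)
Lemma mass_average mu k j psi : lip 1 psi ->
  mass mu k j * average mu k j psi = \int[mu]_(x in dyadic k j) psi (Tdy k j x).
Proof.
move=> l; rewrite /average mulrC; have [m0|m0] := eqVneq (mass mu k j) 0.
  have /andP[] := Rintegral_dyadic_itv mu k j l (lip_itv l).
  by rewrite m0 !mulr0; lra.
by rewrite divfK.
Qed.

Lemma Tdy_left k j x : Tdy k j x = (2 : R)^-1 * Tdy k.+1 j.*2 x.
Proof.
by rewrite /Tdy exprS -mul2n natrM mulrBr !mulrA mulVf ?pnatr_eq0// !mul1r.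
Qed.

Lemma Tdy_right k j x : Tdy k j x = (2 : R)^-1 * Tdy k.+1 j.*2.+1 x + 2^-1.
Proof.
have -> : Tdy k.+1 j.*2.+1 x = Tdy k.+1 j.*2 x - 1.
  by rewrite /Tdy -[j.*2.+1%:R]natr1 opprD addrA.
by rewrite Tdy_left; move: (Tdy k.+1 _ _) => t; lra.
Qed.

(** In the coordinates of a child the test function is traversed at half speed, hence is
    1/2-Lipschitz: this is the source of the factor 1/2 in the recursion for b. *)
Lemma mass_average_split mu k j psi : lip 1 psi ->
  mass mu k j * average mu k j psi =
  mass mu k.+1 j.*2 * average mu k.+1 j.*2 (fun y => psi (2^-1 * y)) +
  mass mu k.+1 j.*2.+1 * average mu k.+1 j.*2.+1 (fun y => psi (2^-1 * y + 2^-1)).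
Proof.
move=> l.
have /andP h : 0 <= (2^-1 : R) /\ (2^-1 : R) <= 1 by split; lra.
have la b : lip 1 (fun y => psi (2^-1 * y + b)).
  move=> x y; have := @lip_affine 2^-1 b 1 psi l _ x y; rewrite !mul1r; apply.
  by case/andP: h => h0 h1; rewrite ger0_norm.
have l0 : lip 1 (fun y => psi (2^-1 * y)).
  by move=> x y; have := la 0 x y; rewrite !addr0.
rewrite !mass_average// [in LHS]dyadicU Rintegral_setU.
- congr (_ + _); apply: eq_Rintegral => x _.
    by rewrite (Tdy_left k j).
  by rewrite (Tdy_right k j).
- exact: measurable_dyadic.
- exact: measurable_dyadic.
- rewrite -dyadicU; exact: lip_integrable (lip_Tdy k j l).
- by apply/disj_setPS; rewrite dyadicI//; apply/eqP; rewrite neq_ltn ltnSn.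
Qed.

Lemma lip1_supp01_lip psi : lip1_supp01 psi -> lip 1 psi.
Proof. by move=> [l _] x y; rewrite mul1r. Qed.

(** The support condition concerns only points outside [0,1]; the endpoints are reached by
    comparison with points at distance e outside. *)
Lemma lip1_supp01_ends psi : lip1_supp01 psi -> psi 0 = 0 /\ psi 1 = 0.
Proof.
move=> [l s]; split; apply/eqP; rewrite -normr_le0; apply/ler_addgt0Pr => e e0.
- have := l 0 (- e); rewrite (s (- e)); last by left; rewrite oppr_lt0.
  by rewrite !(sub0r, opprK, subr0, add0r) => /le_trans; apply; rewrite gtr0_norm.
- have := l 1 (1 + e); rewrite (s (1 + e)); last by right; rewrite ltrDl.
  by rewrite subr0 opprD addrA subrr !add0r normrN (gtr0_norm e0).
Qed.

(** Such a function is bounded by the distance to the nearer endpoint. *)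
Lemma lip1_supp01_itv psi : lip1_supp01 psi ->
  forall y, 0 <= y < 1 -> - 2^-1 <= psi y <= 2^-1.
Proof.
move=> s y /andP[y0 y1]; have [p0 p1] := lip1_supp01_ends s.
have [l _] := s; have := l y 0; have := l y 1; rewrite p0 p1 !subr0.
have y1' : y - 1 <= 0 by rewrite subr_le0 ltW.
by rewrite (ger0_norm y0) (ler0_norm y1') !ler_norml; lra.
Qed.

Lemma int_normalizedE mu k j psi : lip1_supp01 psi ->
  int_normalized mu k j psi = (average mu k j psi)%:E.
Proof.
move=> /lip1_supp01_lip l; have mE : (mu : {measure set R -> \bar R}) (dyadic k j) = (mass mu k j)%:E.
  by rewrite massE.
rewrite /int_normalized /average mE.
case: eqP => [[->]|/eqP m0]; first by rewrite invr0 mulr0.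
have I := lip_integrable mu k j (lip_Tdy k j l).
rewrite EFinM inver; move: m0; rewrite eqe => /negbTE ->; congr (_ * _)%E.
by rewrite /Rintegral fineK//; apply: integrable_fin_num I; exact: measurable_dyadic.
Qed.

Lemma average_norm_le mu k j psi : lip1_supp01 psi -> `|average mu k j psi| <= 2^-1.
Proof.
move=> s; have [m0|m0] := eqVneq (mass mu k j) 0.
  by rewrite /average m0 invr0 mulr0 normr0 invr_ge0.
rewrite ler_norml; apply: average_itv; last exact: lip1_supp01_itv.
  by rewrite lt_neqAle eq_sym m0 fine_ge0.
exact: lip1_supp01_lip.
Qed.

Lemma alphaE mu nu k j : alpha mu nu k j =
  ereal_sup [set (`|average mu k j psi - average nu k j psi|)%:E
            | psi in [set psi | lip1_supp01 psi]].
Proof.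
congr ereal_sup; apply/seteqP; split => _ [psi /= s <-]; exists psi => //;
  by rewrite !int_normalizedE.
Qed.

Definition alphaR mu nu k j : R := fine (alpha mu nu k j).

Lemma alpha_itv mu nu k j : (0 <= alpha mu nu k j <= 1)%E.
Proof.
rewrite alphaE; apply/andP; split; last first.
  apply: ge_ereal_sup => _ [psi s <-]; rewrite lee_fin (le_trans (ler_normB _ _))//.
  have := lerD (average_norm_le mu k j s) (average_norm_le nu k j s); lra.
apply: ereal_sup_ubound => /=; exists (cst 0).
  by split => [x y|//]; rewrite subrr normr0.
by rewrite /average !Rintegral_cst//= ?mul0r ?subrr ?normr0//; exact: measurable_dyadic.
Qed.

Lemma alphaRE mu nu k j : alpha mu nu k j = (alphaR mu nu k j)%:E.
Proof.
rewrite /alphaR fineK//; have /andP[a0 a1] := alpha_itv mu nu k j.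
by rewrite ge0_fin_numE// (le_lt_trans a1)// ltry.
Qed.

Lemma alphaR_itv mu nu k j : 0 <= alphaR mu nu k j <= 1.
Proof. by rewrite -!lee_fin -alphaRE alpha_itv. Qed.

Lemma alphaR_ub mu nu k j psi : lip1_supp01 psi ->
  `|average mu k j psi - average nu k j psi| <= alphaR mu nu k j.
Proof. by move=> s; rewrite -lee_fin -alphaRE alphaE; apply: ereal_sup_ubound; exists psi. Qed.

Lemma alphaR_le mu nu k j (c : R) : (forall psi, lip1_supp01 psi ->
  `|average mu k j psi - average nu k j psi| <= c) -> alphaR mu nu k j <= c.
Proof.
move=> h; rewrite -lee_fin -alphaRE alphaE; apply: ge_ereal_sup => _ [psi s <-].
by rewrite lee_fin h.
Qed.

(** On each level exactly one interval contains x, and these intervals are the ancestors of the one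
    at level K. *)
Lemma square_fun2_partial mu nu x K : 0 <= x < 1 ->
  (\sum_(0 <= k < K.+1) \sum_(j < 2 ^ k)
    (alpha mu nu k j * alpha mu nu k j * (\1_(dyadic k j) x)%:E))%E =
  (path_sum (fun k j => alphaR mu nu k j ^+ 2) K (dyadic_index K x))%:E.
Proof.
move=> x01; have x0 : 0 <= x by case/andP: x01.
have L k : (\sum_(j < 2 ^ k)
    (alpha mu nu k j * alpha mu nu k j * (\1_(dyadic k j) x)%:E))%E =
    (alphaR mu nu k (dyadic_index k x) ^+ 2)%:E.
  rewrite (bigD1 (Ordinal (dyadic_index_lt k x01)))//= big1 ?adde0.
    rewrite indicE mem_set ?mule1; last exact: dyadic_indexP.
    by rewrite alphaRE -EFinM expr2.
  move=> i /eqP ix; rewrite indicE memNset ?mule0// => /dyadic_index_eq xi.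
  by apply: ix; apply: val_inj; rewrite /= xi.
elim: K => [|K IH]; first by rewrite big_nat1 L.
by rewrite big_nat_recr//= IH L /= dyadic_index_half// -EFinD.
Qed.

Lemma square_fun2_term_ge0 mu nu x k : (0 <= \sum_(j < 2 ^ k)
    (alpha mu nu k j * alpha mu nu k j * (\1_(dyadic k j) x)%:E))%E.
Proof.
apply: sume_ge0 => j _; have /andP[a0 _] := alpha_itv mu nu k j.
by rewrite !mule_ge0// lee_fin.
Qed.

Lemma square_fun2_ge mu nu x K : 0 <= x < 1 ->
  ((path_sum (fun k j => alphaR mu nu k j ^+ 2) K (dyadic_index K x))%:E
   <= square_fun2 mu nu x)%E.
Proof.
move=> x01; rewrite -square_fun2_partial//; apply: nneseries_lim_ge => k _ _.
exact: square_fun2_term_ge0.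
Qed.

Lemma square_fun2_le mu nu x (N : R) : 0 <= x < 1 ->
  (forall K, path_sum (fun k j => alphaR mu nu k j ^+ 2) K (dyadic_index K x) <= N) ->
  (square_fun2 mu nu x <= N%:E)%E.
Proof.
move=> x01 h; apply: lime_le.
  by apply: is_cvg_nneseries => k _ _; exact: square_fun2_term_ge0.
near=> K; have K0 : (0 < K)%N by near: K; exact: nbhs_infty_gt.
by rewrite -(prednK K0) square_fun2_partial// lee_fin.
Unshelve. all: by end_near. Qed.

End averages.

(** * Tent functions, and the deviation d bounded by alpha *)

Section wasserstein_and_splitting.
Context {R : realType}.
Implicit Types (mu nu : probability R R) (psi : R -> R) (x y : R).

Definition tent y : R := Num.max 0 (Num.min y (1 - y)).

Lemma tent_itv y : 0 <= tent y <= 2^-1.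
Proof.
by rewrite /tent; case: (leP y (1 - y)) => h; rewrite maxEle; case: ifPn; rewrite -?ltNge => h'; apply/andP; split; lra.
Qed.

Lemma tent_ge y (c : R) : c <= y <= 1 - c -> c <= tent y.
Proof.
move=> /andP[c1 c2]; rewrite /tent; case: (leP y (1 - y)) => h;
  by rewrite maxEle; case: ifPn; rewrite -?ltNge => h'; lra.
Qed.

Lemma tent_eq0 y : y <= 0 \/ 1 <= y -> tent y = 0.
Proof.
by case=> yh; rewrite /tent; case: (leP y (1 - y)) => h; rewrite maxEle; case: ifPn; rewrite -?ltNge => h'; lra.
Qed.

Lemma lip_tent : lip 1 tent.
Proof.
move=> x y; rewrite mul1r ler_norml /tent.
have := ler_norm (x - y); have := ler_norm (y - x); rewrite (distrC y).
by case: (leP x (1 - x)) => h1; case: (leP y (1 - y)) => h2;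
  rewrite !maxEle; case: ifPn; rewrite -?ltNge => h3; case: ifPn; rewrite -?ltNge => h4 h5 h6; apply/andP; split; lra.
Qed.

Lemma tent_supp : lip1_supp01 tent.
Proof.
split=> [x y|x h]; first by have := lip_tent x y; rewrite mul1r.
by apply: tent_eq0; case: h => /ltW; [left|right].
Qed.

Lemma average_eq mu k j psi psi' : (forall y, 0 <= y < 1 -> psi y = psi' y) ->
  average mu k j psi = average mu k j psi'.
Proof.
move=> e; congr (_ / _); apply: eq_Rintegral => x; rewrite inE => /Tdy_itv/e.
by [].
Qed.

Lemma averageZ mu k j psi (c : R) : lip 1 psi ->
  average mu k j (fun y => c * psi y) = c * average mu k j psi.
Proof.
move=> l; rewrite /average mulrA; congr (_ / _).
rewrite RintegralZl//; first exact: measurable_dyadic.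
exact: lip_integrable (lip_Tdy k j l).
Qed.

(** A tent over the left half of [0,1], at the height that keeps it 1-Lipschitz: tested on I, it
    sees only I_-. *)
Let half_tent y := 2^-1 * tent (2 * y).

Let half_tent_supp : lip1_supp01 half_tent.
Proof.
split=> [x y|x h].
  have := @lip_affine _ 2 0 2^-1 tent lip_tent; rewrite mulVf ?pnatr_eq0// normr1.
  by move=> /(_ (lexx _) x y); rewrite !addr0 mul1r.
by rewrite /half_tent tent_eq0 ?mulr0//; case: h => h; [left|right]; lra.
Qed.

Lemma average_half_tent mu k j :
  mass mu k j * average mu k j half_tent =
  2^-1 * (mass mu k.+1 j.*2 * average mu k.+1 j.*2 tent).
Proof.
rewrite mass_average_split; last exact: lip1_supp01_lip half_tent_supp.
have -> : average mu k.+1 j.*2.+1 (fun y => half_tent (2^-1 * y + 2^-1)) =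
    average mu k.+1 j.*2.+1 (fun y => 0 * tent y).
  apply: average_eq => y /andP[y0 y1]; rewrite mul0r /half_tent tent_eq0 ?mulr0//.
  by right; lra.
rewrite (averageZ _ _ _ _ lip_tent) mul0r mulr0 addr0.
rewrite [RHS]mulrCA -(averageZ _ _ _ _ lip_tent); congr (_ * average _ _ _ _).
apply/funext => y.
by rewrite /half_tent mulrA divff ?mul1r// pnatr_eq0.
Qed.

Section doubling.
Variables (nu : probability R R) (C : R).
Hypotheses (C1 : 1 <= C) (tn : tree_measure (mass nu)) (dn : tree_doubling C (mass nu)).

(** The tent is at least 1/4 on the quarter [1/4, 1/2), the right child of the left child, and
    doubling applied twice gives this quarter at least the fraction C^-2 of the mass. *)
Lemma average_tent_ge k j : (j < 2 ^ k)%N -> (4 * C ^+ 2)^-1 <= average nu k j tent.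
Proof.
move=> jk; have C0 : 0 < C by apply: lt_le_trans C1.
have m0 := tree_doubling_gt0 tn dn jk.
have jk1 := expn2S_double jk; have jk2 := expn2S_doubleS jk1.
have d1 : mass nu k j <= C * mass nu k.+1 j.*2 by have := dn jk1; rewrite doubleK.
have d2 : mass nu k.+1 j.*2 <= C * mass nu k.+2 j.*2.*2.+1.
  by have := dn jk2; rewrite /= uphalf_double.
have n2 := tree_doubling_gt0 tn dn jk2.
have h1 := mass_average_split nu k j lip_tent.
have n1 := tree_doubling_gt0 tn dn jk1.
have lq b : lip 1 (fun y => tent (2^-1 * y + b)).
  move=> x y; have := @lip_affine _ 2^-1 b 1 tent lip_tent _ x y; rewrite !mul1r; apply.
  by rewrite ger0_norm; lra.
have lq0 : lip 1 (fun y => tent (2^-1 * y)).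
  by move=> x y; have := lq 0 x y; rewrite !addr0.
have h2 := mass_average_split nu k.+1 j.*2 lq0.
have pos k' j' psi : lip 1 psi -> (forall y, 0 <= psi y) ->
    0 <= mass nu k' j' * average nu k' j' psi.
  move=> l p; rewrite mass_average//; apply: Rintegral_ge0 => // x _; exact: p.
have p1 : 0 <= mass nu k.+1 j.*2.+1 * average nu k.+1 j.*2.+1 (fun y => tent (2^-1 * y + 2^-1)).
  by apply: pos => // y; have /andP[] := tent_itv (2^-1 * y + 2^-1).
have lqq b : lip 1 (fun y => tent (2^-1 * (2^-1 * y + b))).
  move=> x y; apply: (le_trans (lq0 _ _)); rewrite !mul1r opprD addrACA subrr addr0 -mulrBr normrM.
  by rewrite ger0_norm; [have := normr_ge0 (x - y); lra|lra].
have p2 : 0 <= mass nu k.+2 j.*2.*2 * average nu k.+2 j.*2.*2 (fun y => tent (2^-1 * (2^-1 * y))).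
  apply: pos => [|y]; last by have /andP[] := tent_itv (2^-1 * (2^-1 * y)).
  by move=> x y; have := lqq 0 x y; rewrite !addr0.
have /andP[p3 _] : 4^-1 <= average nu k.+2 j.*2.*2.+1 (fun y => tent (2^-1 * (2^-1 * y + 2^-1))) <= 2^-1.
  apply: average_itv => // y /andP[y0 y1]; apply/andP; split.
    by apply: tent_ge; lra.
  by have /andP[] := tent_itv (2^-1 * (2^-1 * y + 2^-1)).
have p4 := ler_wpM2l (ltW n2) p3.
have H : mass nu k.+2 j.*2.*2.+1 / 4 <= mass nu k j * average nu k j tent by lra.
have CC : mass nu k j <= C ^+ 2 * mass nu k.+2 j.*2.*2.+1.
  by apply: (le_trans d1); rewrite expr2 -mulrA ler_wpM2l// ltW.
rewrite -(ler_pM2l m0); apply: le_trans H.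
rewrite ler_pdivrMr ?mulr_gt0 ?exprn_gt0//.
by have := CC; lra.
Qed.

(** The function [half_tent] on I compares the products of left fraction and tent average on I_-;
    [tent] on I_- compares the tent averages themselves. The lower bound on the nu-average then
    isolates the fractions. *)
Lemma split_dev_le_alpha mu k j : tree_measure (mass mu) ->
  (j < 2 ^ k)%N -> 0 < mass mu k j ->
  mass mu k j * `|split_dev (mass mu) (mass nu) k j| <=
  8 * C ^+ 2 * (mass mu k j * alphaR mu nu k j +
                mass mu k.+1 j.*2 * alphaR mu nu k.+1 j.*2).
Proof.
move=> tm jk m0; have n0 := tree_doubling_gt0 tn dn jk.
have C0 : 0 < C by apply: lt_le_trans C1.
have a1 := alphaR_ub mu nu k j half_tent_supp.
have a2 := alphaR_ub mu nu k.+1 j.*2 tent_supp.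
have /andP[a20 _] := alphaR_itv mu nu k.+1 j.*2.
have /andP[a10 _] := alphaR_itv mu nu k j.
have m1 : 0 <= mass mu k.+1 j.*2 by case: tm.
have e1 : average mu k j half_tent = 2^-1 * (mass mu k.+1 j.*2 / mass mu k j * average mu k.+1 j.*2 tent).
  apply: (mulfI (lt0r_neq0 m0)); rewrite average_half_tent [RHS]mulrCA; congr (_ * _).
  by field; rewrite lt0r_neq0.
have e2 : average nu k j half_tent = 2^-1 * (mass nu k.+1 j.*2 / mass nu k j * average nu k.+1 j.*2 tent).
  apply: (mulfI (lt0r_neq0 n0)); rewrite average_half_tent [RHS]mulrCA; congr (_ * _).
  by field; rewrite lt0r_neq0.
have T := average_tent_ge (expn2S_double jk).
rewrite e1 e2 in a1; rewrite /split_dev.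
have r0 : 0 <= mass mu k.+1 j.*2 / mass mu k j by rewrite divr_ge0// ltW.
have rE : mass mu k.+1 j.*2 = mass mu k j * (mass mu k.+1 j.*2 / mass mu k j).
  by rewrite mulrCA divff ?mulr1// lt0r_neq0.
set r := mass mu k.+1 j.*2 / _ in a1 r0 rE *.
rewrite rE; move: a1 a2 a10 a20 T r0 {e1 e2 rE}.
move: r (_ / mass nu k j) (alphaR mu nu k j) (alphaR mu nu k.+1 j.*2).
move: (average mu _ _ _) (average nu _ _ _) => tm1 tn1 r q A A1 a1 a2 A0 A10 T r0.
have -> : 8 * C ^+ 2 * (mass mu k j * A + mass mu k j * r * A1) =
   mass mu k j * (8 * C ^+ 2 * (A + r * A1)) by ring.
apply: ler_wpM2l; first exact: ltW.
have tn0 : 0 < tn1 by apply: lt_le_trans T; rewrite invr_gt0 mulr_gt0// exprn_gt0.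
(* Here r, q are the left fractions and [tm1], [tn1] the tent averages on I_- of mu and nu. *)
have E : `|r - q| * tn1 <= 2 * A + r * A1.
  rewrite -{1}(gtr0_norm tn0) -normrM.
  have -> : (r - q) * tn1 = 2 * (2^-1 * (r * tm1) - 2^-1 * (q * tn1)) - r * (tm1 - tn1) by field.
  rewrite (le_trans (ler_normB _ _))// !normrM (ger0_norm r0) ger0_norm//.
  by rewrite lerD// ler_wpM2l.
have E' : `|r - q| * (4 * C ^+ 2)^-1 <= 2 * A + r * A1.
  by apply: le_trans E; rewrite ler_wpM2l.
rewrite ler_pdivrMr ?mulr_gt0 ?exprn_gt0// in E'.
apply: (le_trans E'); rewrite mulrC.
have -> : 8 * C ^+ 2 * (A + r * A1) = (4 * C ^+ 2) * (2 * A + 2 * (r * A1)) by ring.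
apply: ler_wpM2l; first by rewrite mulr_ge0// sqr_ge0.
rewrite lerD2l.
have := mulr_ge0 r0 A10; lra.
Qed.

End doubling.

(** The support condition of alpha is dropped because the restriction of a test function to a child
    need not vanish at the endpoints; the larger class is stable under splitting. *)
Definition wass1 mu nu k j : R :=
  sup [set `|average mu k j psi - average nu k j psi| | psi in [set psi | lip 1 psi]].

Section wass.
Variables (mu nu : probability R R) (k j : nat).
Hypotheses (mu0 : 0 < mass mu k j) (nu0 : 0 < mass nu k j).

Let diff_le1 psi : lip 1 psi -> `|average mu k j psi - average nu k j psi| <= 1.
Proof.
move=> l; have /andP[] := average_itv mu0 l (lip_itv l).
have /andP[] := average_itv nu0 l (lip_itv l).
rewrite ler_norml; lra.
Qed.

Lemma wass1_ub psi : lip 1 psi ->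
  `|average mu k j psi - average nu k j psi| <= wass1 mu nu k j.
Proof.
move=> l; apply: ub_le_sup; last by exists psi.
by exists 1 => _ [f /diff_le1 h <-].
Qed.

Lemma wass1_le (c : R) :
  (forall psi, lip 1 psi -> `|average mu k j psi - average nu k j psi| <= c) ->
  wass1 mu nu k j <= c.
Proof.
move=> h; apply: ge_sup => [|_ [f /h ? <-]//].
eexists; exists (cst 0); last by reflexivity.
by move=> x y; rewrite subrr normr0 mul1r.
Qed.

Lemma wass1_itv : 0 <= wass1 mu nu k j <= 1.
Proof.
rewrite wass1_le ?andbT; last exact: diff_le1.
apply: le_trans (wass1_ub lip_tent); exact: normr_ge0.
Qed.

Lemma alphaR_le_wass1 : alphaR mu nu k j <= wass1 mu nu k j.
Proof. by apply: alphaR_le => psi /lip1_supp01_lip/wass1_ub. Qed.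

End wass.
End wasserstein_and_splitting.

(** * The recursion for the Wasserstein distance *)

Section energy.
Context {R : realType}.
Variables (mu nu : probability R R) (C : R).
Hypotheses (tm : tree_measure (mass mu)) (tn : tree_measure (mass nu)).
Hypotheses (C1 : 1 <= C) (dn : tree_doubling C (mass nu)).

Let m_ge0 k j : 0 <= mass mu k j. Proof. by case: tm. Qed.
Let n_gt0 k j : (j < 2 ^ k)%N -> 0 < mass nu k j. Proof. exact: (tree_doubling_gt0 tn dn). Qed.

(** If only mu vanishes on the interval, constant test functions make the set in [wass1] unbounded;
    the default 0 is harmless since [beta] enters weighted by the mass of mu. *)
Let beta k j : R :=
  if (j < 2 ^ k)%N && (0 < mass mu k j) then wass1 mu nu k j else 0.

Let beta_itv k j : 0 <= beta k j <= 1.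
Proof.
rewrite /beta; case: ifP => [/andP[jk m0]|_]; last by rewrite lexx ler01.
exact: wass1_itv m0 (n_gt0 jk).
Qed.

(** A 1/2-Lipschitz function is tested through its double. *)
Let beta_ub k j (psi : R -> R) : (j < 2 ^ k)%N -> lip 1 (fun y => 2 * psi y) -> lip 1 psi ->
  mass mu k j * `|average mu k j psi - average nu k j psi| <=
  2^-1 * (mass mu k j * beta k j).
Proof.
move=> jk l2 l; have := m_ge0 k j; rewrite le_eqVlt => /predU1P[<-|m0].
  by rewrite !mul0r mulr0.
rewrite /beta jk m0/= mulrCA; apply: ler_wpM2l; first exact: ltW.
have := wass1_ub m0 (n_gt0 jk) l2; rewrite !averageZ// -mulrBr normrM ger0_norm//; lra.
Qed.

(** The difference of averages splits into a rearrangement inside each child, where the test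
    function is 1/2-Lipschitz, and a transfer of the fraction d between the children, at cost at
    most 1. *)
Lemma wass1_split k j : (j < 2 ^ k)%N -> 0 < mass mu k j ->
  mass mu k j * beta k j <= mass mu k j * `|split_dev (mass mu) (mass nu) k j| +
    2^-1 * (mass mu k.+1 j.*2 * beta k.+1 j.*2 +
            mass mu k.+1 j.*2.+1 * beta k.+1 j.*2.+1).
Proof.
move=> jk m0; rewrite {1}/beta jk m0/= mulrC -ler_pdivlMr//.
have n0 := n_gt0 jk.
have jk1 := expn2S_double jk; have jk2 := expn2S_doubleS jk.
apply: wass1_le => psi l.
have lz b : lip 1 (fun y => 2 * psi (2^-1 * y + b)).
  by apply: lip_affine => //; rewrite divff ?normr1// pnatr_eq0.
have lz0 : lip 1 (fun y => 2 * psi (2^-1 * y)).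
  by move=> x y; have := lz 0 x y; rewrite !addr0.
have lh b : lip 1 (fun y => psi (2^-1 * y + b)).
  move=> x y; have := @lip_affine _ 2^-1 b 1 psi l _ x y; rewrite !mul1r; apply.
  by rewrite ger0_norm; lra.
have lh0 : lip 1 (fun y => psi (2^-1 * y)).
  by move=> x y; have := lh 0 x y; rewrite !addr0.
have M := mass_average_split mu k j l; have N := mass_average_split nu k j l.
have b1 := beta_ub jk1 lz0 lh0; have b2 := beta_ub jk2 (lz _) (lh 2^-1).
(* Both child averages of nu lie within 1/2 of psi(1/2), so they differ by at most 1. *)
have B1 : psi 2^-1 - 2^-1 <= average nu k.+1 j.*2 (fun y => psi (2^-1 * y)) <= psi 2^-1 + 2^-1.
  apply: average_itv => //; first exact: n_gt0.
  by move=> y /andP[y0 y1]; apply: lip_itv => //; apply/andP; split; lra.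
have B2 : psi 2^-1 - 2^-1 <= average nu k.+1 j.*2.+1 (fun y => psi (2^-1 * y + 2^-1)) <= psi 2^-1 + 2^-1.
  apply: average_itv => //; first exact: n_gt0.
  by move=> y /andP[y0 y1]; apply: lip_itv => //; apply/andP; split; lra.
have mE : mass mu k j = mass mu k.+1 j.*2 + mass mu k.+1 j.*2.+1 by case: tm.
have nE : mass nu k j = mass nu k.+1 j.*2 + mass nu k.+1 j.*2.+1 by case: tn.
have m1 := m_ge0 k.+1 j.*2; have m2 := m_ge0 k.+1 j.*2.+1.
rewrite ler_pdivlMr// mulrC /split_dev.
move: (average mu k j psi) (average nu k j psi) M N => A B.
move: (average mu _ _ _) (average mu _ _ _) (average nu _ _ _) (average nu _ _ _) b1 b2 B1 B2 => A2 A1 D2 D1 b1 b2 B1 B2 M N.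
have E : mass mu k j * (A - B) =
    mass mu k.+1 j.*2 * (A1 - D1) + mass mu k.+1 j.*2.+1 * (A2 - D2) +
    mass mu k j * (mass mu k.+1 j.*2 / mass mu k j - mass nu k.+1 j.*2 / mass nu k j) * (D1 - D2).
  have -> : A = (mass mu k.+1 j.*2 * A1 + mass mu k.+1 j.*2.+1 * A2) / mass mu k j.
    by rewrite -M mulrC mulKf ?lt0r_neq0.
  have -> : B = (mass nu k.+1 j.*2 * D1 + mass nu k.+1 j.*2.+1 * D2) / mass nu k j.
    by rewrite -N mulrC mulKf ?lt0r_neq0.
  have -> : mass mu k.+1 j.*2.+1 = mass mu k j - mass mu k.+1 j.*2 by rewrite mE addrC addKr.
  have -> : mass nu k.+1 j.*2.+1 = mass nu k j - mass nu k.+1 j.*2 by rewrite nE addrC addKr.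
  by field; rewrite !lt0r_neq0.
rewrite -[X in X * `|A - B|](gtr0_norm m0) -normrM E.
apply: (le_trans (ler_normD _ _)); rewrite addrC; apply: lerD.
  rewrite normrM normrM (gtr0_norm m0) -[leRHS]mulr1; apply: ler_wpM2l.
    by rewrite mulr_ge0// ltW.
  by move: B1 B2 => /andP[? ?] /andP[? ?]; rewrite ler_norml; apply/andP; split; lra.
apply: (le_trans (ler_normD _ _)); by rewrite !normrM (ger0_norm m1) (ger0_norm m2) mulrDr; exact: lerD.
Qed.

Lemma alpha_energy_le (M : R) : 1 <= M -> forall K,
  \sum_(k < K) \sum_(j < 2 ^ k)
    (~~ ever (density_out (mass mu) (mass nu) M) k j)%:R * mass mu k j * alphaR mu nu k j ^+ 2
  <= 4 * C * M ^+ 2 + 1.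
Proof.
move=> M1 K.
apply: le_trans (energy_sum_le tm tn C1 dn M1 beta_itv wass1_split K).
apply: ler_sum => k _; apply: ler_sum => j _.
case: (boolP (ever _ k j)) => T /=; first by rewrite !mul0r.
rewrite !mul1r; apply: ler_wpM2l => //.
have n0 := n_gt0 (ltn_ord j).
have m0 : 0 < mass mu k j.
  rewrite -(@pmulr_rgt0 _ M) ?(lt_le_trans _ M1)//; apply: lt_le_trans n0 _.
  rewrite leNgt; apply: contra T => h; apply: everP; by rewrite /density_out h.
have := alphaR_le_wass1 m0 n0; have /andP[a0 _] := alphaR_itv mu nu k j.
rewrite /beta ltn_ord m0/= => aw.
by rewrite ler_sqr// nnegrE// (le_trans a0).
Qed.

End energy.

(** * Null sets *)

Section outer_regularity.
Context {R : realType}.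
Variable mu : probability R R.

(* Closed under complement by symmetry, so that these sets form a sigma-algebra. *)
Let open_separated (A : set R) := forall e : R, 0 < e ->
  exists U V : set R, [/\ open U, open V, A `<=` U, ~` A `<=` V & (mu (U `&` V) <= e%:E)%E].

(** The complement is covered by an open ray reaching just beyond x; the overlaps decrease to the
    empty set. *)
Let separated_ray x : open_separated `]x, +oo[%classic.
Proof.
move=> e e0.
pose F n := `]x, x + n.+1%:R^-1[%classic : set R.
have F0 : \bigcap_n F n = set0.
  apply/seteqP; split=> // y Fy.
  have : x < y by have := Fy 0%N I; rewrite /F /= in_itv/= => /andP[].
  move=> /ltr_add_invr[k ky].
  by have := Fy k I; rewrite /F /= in_itv/= => /andP[_ /(lt_trans ky)]; rewrite ltxx.
have mF n : measurable (F n) by exact: measurable_itv.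
have cvg : mu (F n) @[n --> \oo] --> 0%E.
  rewrite -(measure0 mu) -F0; apply: nonincreasing_cvg_mu => //.
  - by rewrite ltey_eq fin_num_measure.
  - exact: bigcapT_measurable.
  - apply/nonincreasing_seqP => n; apply/subsetPset => y.
    rewrite /F /= !in_itv/= => /andP[-> /lt_le_trans]; apply.
    by rewrite lerD2l lef_pV2 ?posrE// ler_nat.
have [n nF] : exists n, (mu (F n) < e%:E)%E.
  have [|n _ /(_ n (leqnn n))] := cvg [set u | (u < e%:E)%E]; last by exists n.
  by apply: open_ereal_lt'; rewrite lte_fin.
exists `]x, +oo[%classic, `]-oo, x + n.+1%:R^-1[%classic; split.
- exact: interval_open.
- exact: interval_open.
- by [].
- move=> y /=; rewrite !in_itv/= andbT => /negP; rewrite -leNgt => yx.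
  by rewrite (le_lt_trans yx)// ltrDl invr_gt0.
- apply: le_trans (ltW nF); apply: le_measure; rewrite ?inE//.
    by apply: measurableI; exact: measurable_itv.
  by move=> y []; rewrite /F/= !in_itv/= andbT => -> ->.
Qed.

(** An infinite intersection of the sets [V n] need not be open, so it is cut off at a finite N by
    continuity from above. *)
Let separated_bigcup (A : (set R)^nat) : (forall n, open_separated (A n)) ->
  open_separated (\bigcup_n A n).
Proof.
move=> sA e e0.
(* These errors sum to e/2; the other half is spent on the cutoff. *)
have e2 n : 0 < e / 2 / (2 ^ n.+1)%:R :> R.
  by rewrite !divr_gt0// ltr0n expn_gt0.
have [U HU] := choice (fun n => sA n _ (e2 n)).
have [V HV] := choice HU.
have oU n : open (U n) by case: (HV n).
have oV n : open (V n) by case: (HV n).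
pose W N := \bigcap_(n < N) V n.
have oW N : open (W N).
  elim: N => [|N IH]; first by have -> : W 0%N = setT by [apply/seteqP; split=> // y _ n]; exact: openT.
  suff -> : W N.+1 = W N `&` V N by apply: openI.
  apply/seteqP; split=> y.
    by move=> Wy; split=> [n /= nN|]; apply: Wy => //=; exact: ltnW.
  move=> [Wy Vy] n /=; rewrite ltnS leq_eqVlt => /predU1P[->//|nN]; exact: Wy.
pose G N := (\bigcup_n U n) `&` W N.
have mU n : measurable (U n) by exact: open_measurable.
have mV n : measurable (V n) by exact: open_measurable.
have mUU : measurable (\bigcup_n U n) by exact: bigcup_measurable.
have mG N : measurable (G N) by apply: measurableI => //; exact: open_measurable.
have mGG : measurable (\bigcap_N G N) by exact: bigcapT_measurable.
have cvg : mu (G N) @[N --> \oo] --> mu (\bigcap_N G N).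
  apply: nonincreasing_cvg_mu => //; first by rewrite ltey_eq fin_num_measure.
  apply/nonincreasing_seqP => N; apply/subsetPset => y [Uy Wy]; split => // n /= nN.
  by apply: Wy; rewrite /= ltnS ltnW.
have small : (mu (\bigcap_N G N) <= (e / 2)%:E)%E.
  have sub : \bigcap_N G N `<=` \bigcup_n (U n `&` V n).
    move=> y Gy; have [[n _ Un] _] := Gy 0%N I; exists n => //; split=> //.
    by have [_ Wy] := Gy n.+1 I; apply: Wy => /=.
  have mUV n : measurable (U n `&` V n) by apply: measurableI.
  apply: le_trans (measure_sigma_subadditive mu mUV mGG sub) _.
  have e20 : 0 <= e / 2 by rewrite divr_ge0// ltW.
  apply: le_trans (epsilon_trick0 xpredT e20); apply: lee_nneseries => // n _.
  by case: (HV n).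
have [N GN] : exists N, (mu (G N) < e%:E)%E.
  have [|N _ /(_ N (leqnn N))] := cvg [set u | (u < e%:E)%E]; last by exists N.
  by apply: open_ereal_lt'; apply: le_lt_trans small _; rewrite lte_fin; lra.
exists (\bigcup_n U n), (W N); split=> //.
- by apply: bigcup_open => n _.
- by move=> y [n _ An]; exists n => //; case: (HV n) => _ _ AU _ _; exact: AU.
- move=> y nAy n _; have [_ _ _ AV _] := HV n; apply: AV => Any.
  by apply: nAy; exists n.
- exact: ltW.
Qed.

(** The separated sets form a sigma-algebra containing the rays, and U minus A lies in the overlap
    of U and V. *)
Lemma probability_outer_regular (A : set R) (e : R) : measurable A -> 0 < e ->
  exists U, [/\ open U, A `<=` U & (mu U <= mu A + e%:E)%E].
Proof.
move=> mA e0.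
have : open_separated A.
  have : (RGenOInfty.G (R:=R)).-sigma.-measurable A by rewrite -RGenOInfty.measurableE.
  apply: smallest_sub; last by move=> _ [x ->]; exact: separated_ray.
  split; [| |exact: separated_bigcup].
  - move=> r r0; exists set0, setT; split; [exact: open0|exact: openT|by []|by []|].
    by rewrite set0I measure0 lee_fin ltW.
  - move=> B sB r /sB [U [V [oU oV BU BV UV]]]; exists V, U; split=> //.
    + by move=> x [_]; exact: BV.
    + by rewrite setTD setCK.
    + by rewrite setIC.
move=> /(_ e e0)[U [V [oU oV AU AV UV]]]; exists U; split=> //.
have mU := open_measurable oU; have mV := open_measurable oV.
apply: (@le_trans _ _ (mu (A `|` (U `&` V)))).
  apply: le_measure; rewrite ?inE//; first by apply: measurableU => //; exact: measurableI.
  move=> x Ux; have [Ax|nAx] := pselect (A x); [by left|right; split=> //; exact: AV].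
apply: le_trans (leeD2l _ UV).
by apply: measureU2 => //; exact: measurableI.
Qed.

End outer_regularity.

(** * Negligible sets obtained from the tree estimates *)

Section null_sets.
Context {R : realType}.
Implicit Types (mu nu : probability R R) (x : R).

(** This says inf p > 0 almost everywhere for mu; with the measures exchanged, sup p < oo almost
    everywhere for nu. *)
Lemma density_ratio_negligible mu nu :
  tree_measure (mass mu) -> tree_measure (mass nu) ->
  mu.-negligible [set x | 0 <= x < 1 /\ forall N : nat, exists k,
    N.+1%:R * mass mu k (dyadic_index k x) < mass nu k (dyadic_index k x)].
Proof.
move=> tm tn; apply: negligible_of_cover => eps e0.
have [N] := ltr_add_invr e0; rewrite add0r => Ne.
have N0 : (0 : R) < N.+1%:R by rewrite ltr0n.
exists (ever (fun k j => N.+1%:R * mass mu k j < mass nu k j)); split.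
- exact: ever_hereditary.
- move=> K; apply: (@le_trans _ _ (N.+1%:R^-1 * 1)); last by rewrite mulr1 ltW.
  apply: le_trans (ever_mass_le (c := N.+1%:R^-1) _ tm tn _ _) _.
  + by rewrite invr_ge0 ltW.
  + by move=> k j _ /ltW; rewrite -ler_pdivlMl.
  + apply: ler_wpM2l; first by rewrite invr_ge0 ltW.
    apply: (level_sum_le (w := fun k j => (ever _ k j)%:R) tn) => j _.
    by case: (ever _ _ _); rewrite ?lexx ?ler01.
- move=> x [x01 /(_ N)[k kN]]; split=> //; exists k; exact: everP.
Qed.

Lemma path_sum_index (w w' : nat -> nat -> R) K x : 0 <= x ->
  (forall k, w k (dyadic_index k x) = w' k (dyadic_index k x)) ->
  path_sum w K (dyadic_index K x) = path_sum w' K (dyadic_index K x).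
Proof.
move=> x0 ww'; elim: K => [|K IH]; first exact: ww'.
by rewrite /= dyadic_index_half// IH ww'.
Qed.

Lemma path_sum_parent_le (w : nat -> nat -> R) k j : (forall k j, 0 <= w k j) ->
  path_sum w k j./2 <= path_sum w k.+1 j.
Proof. by move=> w0; rewrite /= lerDl. Qed.

Section fixed_pair.
Variables (mu nu : probability R R) (C : R).
Hypotheses (tm : tree_measure (mass mu)) (tn : tree_measure (mass nu)).
Hypotheses (C1 : 1 <= C) (dn : tree_doubling C (mass nu)).

Let m_ge0 k j : 0 <= mass mu k j. Proof. by case: tm. Qed.

(** Chebyshev's inequality for the stopped square sum, whose mu-integral is at most B; the level B /
    eps leaves mass at most eps. *)
Lemma square_fun2_infty_negligible (M : R) : 1 <= M ->
  mu.-negligible [set x | 0 <= x < 1 /\ ~ (square_fun2 mu nu x < +oo)%E /\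
    forall k, ~~ density_out (mass mu) (mass nu) M k (dyadic_index k x)].
Proof.
move=> M1; apply: negligible_of_cover => eps e0.
pose B := 4 * C * M ^+ 2 + 1.
have M0 : 0 < M by apply: lt_le_trans M1.
have C0 : 0 < C by apply: lt_le_trans C1.
have B0 : 0 < B by rewrite addr_gt0// !mulr_gt0// exprn_gt0.
pose w k j : R := (~~ ever (density_out (mass mu) (mass nu) M) k j)%:R * alphaR mu nu k j ^+ 2.
have w0 k j : 0 <= w k j by rewrite mulr_ge0 ?sqr_ge0.
pose lam := B / eps; have lam0 : 0 < lam by rewrite divr_gt0.
exists (fun k j => lam < path_sum w k j); split.
- by move=> k j /lt_le_trans; apply; apply: path_sum_parent_le.
- move=> K; rewrite -(ler_pM2l lam0).
  have -> : lam * eps = B by rewrite divfK// gt_eqF.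
  apply: le_trans (alpha_energy_le tm tn C1 dn M1 K.+1).
  apply: (@le_trans _ _ (\sum_(j < 2 ^ K) mass mu K j * path_sum w K j)).
    rewrite mulr_sumr; apply: ler_sum => j _; rewrite mulrCA ler_wpM2l//.
    case: ltP => [/ltW h|_]; first by rewrite mulr1.
    by rewrite mulr0; exact: path_sum_ge0.
  rewrite -sum_path_sum//; apply: ler_sum => k _; apply: ler_sum => j _.
  by rewrite /w mulrCA mulrA.
- move=> x [x01 [Soo dx]]; split=> //; apply: contrapT => nK; apply: Soo.
  have x0 : 0 <= x by case/andP: x01.
  apply: (@le_lt_trans _ _ lam%:E); last exact: ltry.
  apply: square_fun2_le => // K; rewrite leNgt; apply/negP => h; apply: nK; exists K.
  (* The path of x is never stopped, so the stopped sum is the full one. *)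
  rewrite (path_sum_index K x0 (w' := fun k j => alphaR mu nu k j ^+ 2))// => k.
  rewrite /w; case: (boolP (ever _ _ _)) => [/(everN_index x0)[k' h']|_]; last by rewrite mul1r.
  by have := dx k'; rewrite h'.
Qed.

Lemma bounded_square_fun2_negligible (N : R) : 1 <= N ->
  mu.-negligible [set x | 0 <= x < 1 /\ (square_fun2 mu nu x <= N%:E)%E /\
    forall L : nat, exists k,
      L.+1%:R * mass nu k (dyadic_index k x) < mass mu k (dyadic_index k x)].
Proof.
move=> N1; apply: negligible_of_cover => eps e0.
have C0 : 0 < C by apply: lt_le_trans C1.
pose D := 8 * C ^+ 2.
pose B := ln 2 + C ^+ 2 * (4 * D ^+ 2 * (N + 1)).
have B0 : 0 < B.
  apply: ltr_pwDl; first by rewrite ln_gt0// ltr1n.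
  have N0 : 0 <= N + 1 by rewrite addr_ge0// (le_trans _ N1).
  apply: mulr_ge0; first exact: sqr_ge0.
  by apply: mulr_ge0 => //; apply: mulr_ge0 => //; exact: sqr_ge0.
(* Chosen so that B / ln(1 + M) <= eps. *)
pose M := expR (B / eps).
have M1 : 1 <= M by rewrite -expR0 ler_expR divr_ge0 ?ltW.
have dev k j : (j < 2 ^ k)%N -> 0 < mass mu k j ->
   mass mu k j * `|split_dev (mass mu) (mass nu) k j| <=
   D * (mass mu k j * alphaR mu nu k j + mass mu k.+1 j.*2 * alphaR mu nu k.+1 j.*2).
  by move=> jk m0; apply: (split_dev_le_alpha C1).
have lnM : B / eps <= ln (1 + M).
  by rewrite -[leLHS]expRK ler_ln ?posrE ?expR_gt0// ?lerDr// addr_gt0// expR_gt0.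
exists (ever (dense_exit (mass mu) (mass nu) (alphaR mu nu) M N)); split.
- exact: ever_hereditary.
- move=> K; have := dense_exit_mass_le tm tn C1 dn (@alphaR_itv _ mu nu) dev M1 N1 K.
  rewrite -/B; set s := \sum_(_ < _) _ => h.
  have s0 : 0 <= s by apply: sumr_ge0 => j _; rewrite mulr_ge0.
  have := le_trans (ler_wpM2r s0 lnM) h.
  by rewrite mulrAC ler_pdivrMr// ler_pM2l.
- move=> x [x01 [SN h]]; split=> //; have x0 : 0 <= x by case/andP: x01.
  have [k hk] := h (Num.truncn M); exists k; apply: everP; rewrite /dense_exit.
  apply/andP; split.
    apply: le_lt_trans hk; apply: ler_wpM2r; first by case: tn.
    exact/ltW/truncnS_gt.
  by rewrite -lee_fin; apply: le_trans SN; apply: square_fun2_ge.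
Qed.

(** An open set around A of nu-measure at most eps / M contains a dyadic interval around each such
    point; on these intervals mu <= M nu, and the maximal ones are disjoint. *)
Lemma bounded_density_negligible (A : set R) (M : R) : 0 < M ->
  measurable A -> nu A = 0%E ->
  mu.-negligible [set x | 0 <= x < 1 /\ A x /\
    forall k, mass mu k (dyadic_index k x) <= M * mass nu k (dyadic_index k x)].
Proof.
move=> M0 mA nuA; apply: negligible_of_cover => eps e0.
have [U [oU AU nuU]] := probability_outer_regular nu mA (divr_gt0 e0 M0).
rewrite nuA add0e in nuU.
pose b k j := `[< dyadic k j `<=` U >] && (mass mu k j <= M * mass nu k j).
exists (ever b); split; first exact: ever_hereditary.
- move=> K; apply: le_trans (ever_mass_le (c := M) _ tm tn _ _) _.
  + exact: ltW.
  + by move=> k j _ /andP[].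
  + rewrite mulrC -ler_pdivlMr// -lee_fin -dyadic_cover_mass; apply: le_trans nuU.
    apply: le_measure; rewrite ?inE; [exact: measurable_dyadic_cover|exact: open_measurable|].
    move=> x /dyadic_coverP[/andP[x0 _]] /(everN_index x0)[k /andP[/asboolP kU _]].
    by apply: kU; apply: dyadic_indexP.
- move=> x [x01 [Ax dx]]; split=> //; have x0 : 0 <= x by case/andP: x01.
  have /nbhs_ballP[e /= e1 eU] : nbhs x U by apply: open_nbhs_nbhs; split=> //; exact: AU.
  have [k ke] : exists k : nat, 2 ^- k < e.
    have [k] := ltr_add_invr e1; rewrite add0r => ke; exists k; apply: le_lt_trans ke.
    by rewrite -natrX lef_pV2 ?posrE ?ltr0n ?expn_gt0// ler_nat ltn_expl.
  exists k; apply: everP; rewrite /b dx andbT; apply/asboolP => y /dyadicP hy.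
  apply: eU; have /dyadicP hx := dyadic_indexP k x0.
  have p0 : (0 : R) < 2 ^+ k by rewrite exprn_gt0.
  apply: lt_trans ke; rewrite -(ltr_pM2l p0) divff ?gt_eqF//.
  rewrite -[X in X * `|_|](gtr0_norm p0) -normrM mulrBr ltr_norml.
  move: hx hy; rewrite -natr1 => /andP[? ?] /andP[? ?]; apply/andP; split; lra.
Qed.

End fixed_pair.
End null_sets.

(** * Passage to the absolutely continuous and singular parts *)

Lemma negligible_le (R : realType) (m1 m2 : {measure set R -> \bar R}) (X : set R) :
  (forall A, measurable A -> (m1 A <= m2 A)%E) -> m2.-negligible X -> m1.-negligible X.
Proof.
move=> le12 [B [mB B0 XB]]; exists B; split=> //.
by apply/eqP; rewrite eq_le measure_ge0 andbT -B0 le12.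
Qed.

Theorem mainTheorem1 (R : realType) (mu nu : probability R R)
  (mu_a mu_s : {measure set R -> \bar R}) :
  mu (~` `[0, 1[%classic) = 0%E ->
  nu (~` `[0, 1[%classic) = 0%E ->
  (forall k j : nat, mu [set (j%:R / 2 ^+ k : R)] = 0%E) ->
  (exists C : R, 1 <= C /\
     forall k j : nat, (j < 2 ^ k.+1)%N ->
       (nu (dyadic k j./2) <= C%:E * nu (dyadic k.+1 j))%E) ->
  (forall A, measurable A -> mu A = (mu_a A + mu_s A)%E) ->
  mu_a `<< nu ->
  mutually_singular mu_s nu ->
  {ae mu_a, forall x, 0 <= x < 1 -> (square_fun2 mu nu x < +oo)%E} /\
  {ae mu_s, forall x, 0 <= x < 1 -> square_fun2 mu nu x = +oo%E}.
Proof.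
move=> mu01 nu01 _ [C [C1 dbl]] muE mu_a_nu [A [mA nuA mu_sA]].
have tm := mass_tree mu01; have tn := mass_tree nu01.
have dn := mass_doubling dbl.
have le_a B : measurable B -> (mu_a B <= mu B)%E by move=> mB; rewrite muE// leeDl.
have le_s B : measurable B -> (mu_s B <= mu B)%E by move=> mB; rewrite muE// leeDr.
split.
- have Z1 : mu_a.-negligible (\bigcup_N [set x : R | 0 <= x < 1 /\
      ~ (square_fun2 mu nu x < +oo)%E /\
      forall k, ~~ density_out (mass mu) (mass nu) N.+1%:R k (dyadic_index k x)]).
    apply: negligible_bigcup => N; apply: (negligible_le le_a).
    by apply: (square_fun2_infty_negligible tm tn C1 dn); rewrite ler1n.
  have Z2 := negligible_le le_a (density_ratio_negligible tm tn).
  (* Finiteness of sup p is known only up to a nu-null set; absolute continuity makes that set null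
     for [mu_a]. *)
  have [B [mB nuB ZB]] := density_ratio_negligible tn tm.
  have mu_aB : mu_a B = 0%E.
    by apply/(measure0_null_setP _ mB)/mu_a_nu/(measure0_null_setP _ mB).
  have ZB' : mu_a.-negligible B by exists B; split.
  apply: negligibleS (negligibleU (negligibleU Z1 Z2) ZB').
  move=> x /= /not_implyP [x01 Soo].
  have [?|nB] := pselect (B x); [by right|left].
  apply: contrapT => /not_orP[n1 n2].
  have [N1 h1] : exists N : nat, forall k,
      mass nu k (dyadic_index k x) <= N.+1%:R * mass mu k (dyadic_index k x).
    apply: contrapT => h; apply: n2; split=> // N; apply: contrapT => h'; apply: h.
    by exists N => k; rewrite leNgt; apply/negP => lt; apply: h'; exists k.
  have [N2 h2] : exists N : nat, forall k,
      mass mu k (dyadic_index k x) <= N.+1%:R * mass nu k (dyadic_index k x).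
    apply: contrapT => h; apply: nB; apply: ZB; split=> // N; apply: contrapT => h'; apply: h.
    by exists N => k; rewrite leNgt; apply/negP => lt; apply: h'; exists k.
  apply: n1; exists (maxn N1 N2) => //; split=> //; split=> // k.
  rewrite /density_out negb_or -!leNgt; apply/andP; split.
    apply: (le_trans (h1 k)); apply: ler_wpM2r; first by case: tm.
    by rewrite ler_nat ltnS leq_maxl.
  apply: (le_trans (h2 k)); apply: ler_wpM2r; first by case: tn.
  by rewrite ler_nat ltnS leq_maxr.
(* A point with finite sum lies off A, or in A with bounded p, or has unbounded p and a sum below
   some N. *)
- have Z1 : mu_s.-negligible (\bigcup_N [set x : R | 0 <= x < 1 /\
      (square_fun2 mu nu x <= N.+1%:R%:E)%E /\ forall L : nat, exists k,
      L.+1%:R * mass nu k (dyadic_index k x) < mass mu k (dyadic_index k x)]).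
    apply: negligible_bigcup => N; apply: (negligible_le le_s).
    by apply: (bounded_square_fun2_negligible tm tn C1 dn); rewrite ler1n.
  have Z2 : mu_s.-negligible (\bigcup_N [set x : R | 0 <= x < 1 /\ A x /\ forall k,
      mass mu k (dyadic_index k x) <= N.+1%:R * mass nu k (dyadic_index k x)]).
    apply: negligible_bigcup => N; apply: (negligible_le le_s).
    by apply: bounded_density_negligible => //; rewrite ltr0n.
  have Z3 : mu_s.-negligible (~` A) by exists (~` A); split=> //; exact: measurableC.
  apply: negligibleS (negligibleU (negligibleU Z1 Z2) Z3).
  move=> x /= /not_implyP [x01 Sfin].
  have [Ax|] := pselect (A x); [left|by right].
  (* This lower bound excludes the value -oo, so that a sum other than +oo is a real number. *)
  have S0 := square_fun2_ge mu nu 0 x01.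
  have [|h] := pselect (exists L : nat, forall k,
      mass mu k (dyadic_index k x) <= L.+1%:R * mass nu k (dyadic_index k x)).
    by move=> [L hL]; right; exists L.
  left; exists (Num.truncn (fine (square_fun2 mu nu x))) => //; split=> //; split.
    have Sr : square_fun2 mu nu x \is a fin_num.
      rewrite fin_numE; apply/andP; split; last exact/eqP.
      by apply/eqP => SE; move: S0; rewrite SE leNgt ltNyr.
    by rewrite -[leLHS](fineK Sr) lee_fin ltW// truncnS_gt.
  move=> L; apply: contrapT => h'; apply: h; exists L => k.
  by rewrite leNgt; apply/negP => lt; apply: h'; exists k.
Qed.
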